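(* Let $m$ be the Lebesgue measure on $\mathbb{C}$, let $\lambda$ be a probability measure on $\mathbb{N}$, and let $\pi_m^\lambda$ be the marked Poisson measure on the marked configuration space $\Gamma(\mathbb{C},\mathbb{N})$, i.e. the restriction to $\Gamma(\mathbb{C},\mathbb{N})$ of the Poisson measure $\pi_{m\otimes\lambda}$ on $\Gamma(\mathbb{C}\times\mathbb{N})$. Assume that $$\int_{\mathbb{N}} n\,d\lambda(n)=\sum_{n\in\mathbb{N}} n\,\lambda(\{n\})<\infty.$$ Then for each natural number $p\geq 2$ and for $\pi_m^\lambda$-almost all $\hat\gamma=\{(x,n_x)\mid x\in\gamma\}\in\Gamma(\mathbb{C},\mathbb{N})$, the product $$\Pi_p(z,\hat\gamma)=\prod_{x\in\gamma,\; x\neq 0}\left(E_p\!\left(\frac{z}{x}\right)\right)^{n_x}$$ exists (converges) for all $z\in\mathbb{C}$, and $z\mapsto\Pi_p(z,\hat\gamma)$ is an entire function on $\mathbb{C}$.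
   Context: For $p\in\mathbb{N}=\{1,2,\dots\}$ the elementary factor $E_p$ is $E_p(z)=(1-z)\exp\{z+\frac{z^2}{2}+\dots+\frac{z^p}{p}\}$, $z\in\mathbb{C}$. For $X=\mathbb{C}$ or $X=\mathbb{C}\times\mathbb{N}$ ($\mathbb{N}$ discrete), $\Gamma(X)$ denotes the space of all locally finite subsets of $X$ (called configurations), i.e. subsets having finitely many points in every compact set. For $f\in C_0(X)$ (continuous with compact support) put $\langle f,\eta\rangle=\sum_{y\in\eta}f(y)$; $\Gamma(X)$ carries the usual $\sigma$-algebra generated by the maps $\eta\mapsto\langle f,\eta\rangle$, $f\in C_0(X)$. For a (non-atomic) Radon measure $\sigma$ on $X$, the Poisson measure $\pi_\sigma$ is the probability measure on $\Gamma(X)$ defined via the Laplace transform $$\int_{\Gamma(X)} e^{\langle f,\eta\rangle}\,d\pi_\sigma(\eta)=\exp\left(\int_{X}\left(e^{f(y)}-1\right)d\sigma(y)\right),\qquad f\in C_0(X).$$ The Lebesgue measure is $m(dz)=dx\,dy$, $z=x+iy$. The marked configuration space $\Gamma(\mathbb{C},\mathbb{N})$ is the set of all $\hat\gamma=\{(x,n_x)\mid x\in\gamma\}$ with $\gamma\in\Gamma(\mathbb{C})$ and marks $n_x\in\mathbb{N}$ (exactly one mark for each point $x\in\gamma$). One has $\Gamma(\mathbb{C},\mathbb{N})\subset\Gamma(\mathbb{C}\times\mathbb{N})$, and $\Gamma(\mathbb{C},\mathbb{N})$ has full $\pi_{m\otimes\lambda}$-measure, so the restriction $\pi_m^\lambda$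 of $\pi_{m\otimes\lambda}$ to $\Gamma(\mathbb{C},\mathbb{N})$ is a probability measure. The product over the (countable, unordered) set $\{x\in\gamma: x\neq 0\}$ is understood as an infinite product over that set whose convergence and value do not depend on an enumeration of it. *)

(* Defs.v *)
From HB Require Import structures.
From mathcomp Require Import all_boot all_order all_algebra finmap.
From mathcomp Require Import complex.
From mathcomp Require Import all_classical all_reals all_analysis.
From mathcomp Require showcase.summability.

Set Implicit Arguments.
Unset Strict Implicit.
Unset Printing Implicit Defensive.

Import Order.TTheory GRing.Theory Num.Theory.
Import numFieldNormedType.Exports.

Local Open Scope classical_set_scope.
Local Open Scope ring_scope.
Local Open Scope complex_scope.

#[non_forgetful_inheritance]
HB.instance Definition _ (R : rcfType) := NormedModule.copy R[i] R[i]^o.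

(* The sigma-algebra of C is transported from R * R by z |-> (Re z, Im z). It is
   the Borel one, since R * R is second countable. *)
#[non_forgetful_inheritance]
HB.instance Definition _ (R : realType) :=
  Measurable.copy R[i] (g_sigma_algebra_preimageType
    ((fun z : R[i] => (complex.Re z, complex.Im z)) : R[i] -> (R * R)%type)).

Definition complex_of_pair (R : realType) (xy : R * R) : R[i] := xy.1 +i* xy.2.

Lemma measurable_complex_of_pair (R : realType) :
  measurable_fun [set: R * R] (@complex_of_pair R).
Proof.
move=> _ _ [B mB <-]; rewrite !setTI.
by rewrite (_ : _ @^-1` _ = B)//; apply/seteqP; split=> -[].
Qed.

(* dx dy, for z = x + iy. *)
Definition area (R : realType) : set R[i] -> \bar R :=
  pushforward (@lebesgue_measure R \x @lebesgue_measure R)%E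
    (@complex_of_pair R).

HB.instance Definition _ (R : realType) := Measure.copy (@area R)
  (measure_function_pushforward__canonical__measure_function_Measure
     (@lebesgue_measure R \x @lebesgue_measure R)%E
     (@measurable_complex_of_pair R)).

(* The mark space {1, 2, ...}; [nat] itself would add the mark 0. *)
Definition posnat := {n : nat | (0 < n)%N}.

HB.instance Definition _ := Countable.on posnat.
HB.instance Definition _ := isPointed.Build posnat (exist _ 1%N isT).
HB.instance Definition _ := hasNbhs.Build posnat principal_filter.
HB.instance Definition _ := Discrete_ofNbhs.Build posnat erefl.

Lemma posnat_measurable0 : discrete_measurable (set0 : set posnat).
Proof. by []. Qed.
Lemma posnat_measurableC (A : set posnat) :
  discrete_measurable A -> discrete_measurable (~` A).
Proof. by []. Qed.
Lemma posnat_measurableU (F : (set posnat)^nat) :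
  (forall i, discrete_measurable (F i)) -> discrete_measurable (\bigcup_i F i).
Proof. by []. Qed.
HB.instance Definition _ := @isMeasurable.Build default_measure_display posnat
  discrete_measurable posnat_measurable0 posnat_measurableC posnat_measurableU.

Section Configurations.
Variable X : topologicalType.

Definition locally_finite (A : set X) :=
  forall K : set X, compact K -> finite_set (A `&` K).

Record config := Config {
  points :> set X ;
  points_locally_finite : locally_finite points }.

Lemma locally_finite0 : locally_finite set0.
Proof. by move=> K _; rewrite set0I. Qed.

HB.instance Definition _ := gen_eqMixin config.
HB.instance Definition _ := gen_choiceMixin config.
HB.instance Definition _ := isPointed.Build config (Config locally_finite0).

Variable R : realType.

Definition C0 : set (X -> R) :=
  [set f | continuous f /\ compact (closure [set x | f x != 0])].

(* For f in C0, only finitely many points of eta are in the support of f, so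
   this finitely supported sum is the sum over all of eta. *)
Definition pairing (f : X -> R) (eta : config) : R := \sum_(y \in eta) f y.

Definition pairing_sets : set (set config) :=
  \bigcup_(f in C0) preimage_set_system setT (pairing f) measurable.

Definition Gamma := g_sigma_algebraType pairing_sets.

HB.instance Definition _ := Measurable.on Gamma.

End Configurations.

(* The Laplace transform that characterizes the Poisson measure of intensity
   sigma on Gamma(C * N). *)
Definition is_poisson (R : realType) (sigma : {measure set (R[i] * posnat) -> \bar R})
    (P : probability (Gamma (R[i] * posnat)%type R) R) :=
  forall f : R[i] * posnat -> R, C0 f ->
    (\int[P]_eta (expR (pairing f eta))%:E =
     (expR (\int[sigma]_y (expR (f y) - 1))%R)%:E)%E.

Section MarkedConfigurations.
Variable R : realType.
Local Notation C := R[i].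

Definition is_marked (eta : config (C * posnat)%type) :=
  exists (gamma : config C) (n : C -> posnat),
    points eta = [set (x, n x) | x in points gamma].

Record marked_config := MarkedConfig {
  unmark :> config (C * posnat)%type ;
  unmark_marked : is_marked unmark }.

Lemma is_marked0 : is_marked point.
Proof. by exists point, (fun=> point); rewrite /= image_set0. Qed.

HB.instance Definition _ := gen_eqMixin marked_config.
HB.instance Definition _ := gen_choiceMixin marked_config.
HB.instance Definition _ := isPointed.Build marked_config (MarkedConfig is_marked0).

Definition marked_inclusion (eta : marked_config) : Gamma (C * posnat)%type R :=
  unmark eta.

(* Gamma(C, N) with the trace of the sigma-algebra of Gamma(C * N). *)
Definition markedGamma := g_sigma_algebra_preimageType marked_inclusion.

HB.instance Definition _ := Measurable.on markedGamma.

(* P is the restriction of Q to Gamma(C, N): as this set has full Q-measure,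
   the trace of A on it has measure Q A. *)
Definition is_restriction (Q : probability (Gamma (C * posnat)%type R) R)
    (P : probability markedGamma R) :=
  forall A : set (Gamma (C * posnat)%type R), measurable A ->
    P (marked_inclusion @^-1` A) = Q A.

Definition is_marked_poisson (lambda : probability posnat R)
    (P : probability markedGamma R) :=
  exists Q : probability (Gamma (C * posnat)%type R) R,
    is_poisson (@area R \x lambda)%E Q /\ is_restriction Q P.

Definition ground (eta : marked_config) : set C := fst @` points eta.

Definition mark (eta : marked_config) (x : C) : posnat :=
  get [set n | points eta (x, n)].

End MarkedConfigurations.

Section UnorderedProducts.
Variables (R : realType) (I : choiceType).

Definition partial_prod (S : set I) (g : I -> R[i]) (F : {fset I}) : R[i] :=
  \prod_(x <- F | x \in S) g x.

(* Convergence along the finite subsets of S is convergence to the same value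
   along every enumeration of S. As usual for infinite products, the limit has
   to be nonzero once finitely many factors are left out. *)
Definition prod_converges (S : set I) (g : I -> R[i]) :=
  exists (F0 : {fset I}) (l : R[i]), l != 0 /\
    partial_prod (S `\` [set` F0]) g @ summability.totally --> l.

Definition unordered_prod (S : set I) (g : I -> R[i]) : R[i] :=
  lim (partial_prod S g @ summability.totally).

End UnorderedProducts.

Section EntireProduct.
Variable R : realType.
Local Notation C := R[i].

Definition cexp (z : C) : C :=
  (expR (complex.Re z))%:C * (cos (complex.Im z) +i* sin (complex.Im z)).

Definition elementary_factor (p : nat) (z : C) : C :=
  (1 - z) * cexp (\sum_(1 <= k < p.+1) z ^+ k / k%:R).

Definition Pi_support (eta : marked_config R) : set C :=
  [set x | ground eta x /\ x != 0].

Definition Pi_factor (p : nat) (z : C) (eta : marked_config R) (x : C) : C :=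
  elementary_factor p (z / x) ^+ val (mark eta x).

Definition Pi_prod (p : nat) (eta : marked_config R) (z : C) : C :=
  unordered_prod (Pi_support eta) (Pi_factor p z eta).

(* Complex differentiability: the derivative is taken over the field C. *)
Definition entire (f : C -> C) := forall z : C, derivable f z (1 : C).

End EntireProduct.

(* Main.v *)
(* For [|w|] bounded, [E_p(w) - 1 = O(|w|^3)] as soon as [p >= 2], so everything
   rests on the almost sure finiteness of the sum of [n_x (1 + |x|)^-3]. That sum
   is [<f, eta>] for [f(x, n) = n (1 + |x|)^-3], whose integral against
   [m (x) lambda] is finite: bound [E exp (- <f_k, eta> / a)] from below for
   compactly supported [f_k] increasing to (a bound of) [f], apply Markov's
   inequality to [1 - exp (- <f_k, eta> / a)], and let [k] and then [a] go to
   infinity.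

   Holomorphy of the limit is obtained without Cauchy's theorem. Fix [z] and
   expand each factor as [f(h) = f0 + h f1 + h^2 f2(h)] on [|h| <= 1]. The
   quantity [|f0| + |f1| + sup |f2|] is submultiplicative, so the bounds on the
   single factors give a bound on the finite products that does not depend on
   the finite set. The difference quotients of the finite products at [h] and
   [k] then differ by at most [C (|h| + |k|)]; this passes to the limit, whose
   difference quotient is therefore Cauchy as [h] tends to [0]. *)

From HB Require Import structures.
Require Import Defs.
From mathcomp Require Import all_boot all_order all_algebra complex.
From mathcomp Require Import all_classical all_reals all_analysis.
From mathcomp Require Import finmap measurable_realfun ring lra.
From mathcomp Require showcase.summability.

Set Implicit Arguments.
Unset Strict Implicit.
Unset Printing Implicit Defensive.

Import Order.TTheory GRing.Theory Num.Theory.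
Import numFieldNormedType.Exports.

Local Open Scope classical_set_scope.
Local Open Scope ring_scope.
Local Open Scope complex_scope.

(* [`|z|] is an element of [R[i]]; estimates are stated with its real version. *)
Notation modulus := ComplexField.Normc.normc.

(** * The modulus as a real-valued function *)

Section Modulus.
Variable R : realType.
Implicit Types z w : R[i].

Lemma modulusE z : `|z| = (modulus z)%:C.
Proof. by []. Qed.

Lemma modulus_ge0 z : 0 <= modulus z.
Proof. by rewrite -lecR -modulusE normr_ge0. Qed.

Lemma modulus0 : modulus (0 : R[i]) = 0.
Proof. exact: ComplexField.Normc.normc0. Qed.

Lemma modulus1 : modulus (1 : R[i]) = 1.
Proof. exact: ComplexField.Normc.normc1. Qed.

Lemma modulus_eq0 z : (modulus z == 0) = (z == 0).
Proof.
apply/eqP/eqP => [|->]; last exact: modulus0.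
exact: ComplexField.Normc.eq0_normc.
Qed.

Lemma modulus_gt0 z : z != 0 -> 0 < modulus z.
Proof. by move=> z0; rewrite lt_def modulus_eq0 z0 modulus_ge0. Qed.

Lemma modulusM z w : modulus (z * w) = modulus z * modulus w.
Proof. exact: ComplexField.Normc.normcM. Qed.

Lemma modulusV z : modulus z^-1 = (modulus z)^-1.
Proof. exact: ComplexField.Normc.normcV. Qed.

Lemma modulusX z n : modulus (z ^+ n) = modulus z ^+ n.
Proof.
by elim: n => [|n IH]; rewrite ?expr0 ?modulus1// !exprS modulusM IH.
Qed.

Lemma modulusN z : modulus (- z) = modulus z.
Proof. exact: normcN. Qed.

Lemma modulusD z w : modulus (z + w) <= modulus z + modulus w.
Proof. exact: le_normcD. Qed.

Lemma modulusB z w : modulus (z - w) <= modulus z + modulus w.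
Proof. by rewrite -(modulusN w); exact: modulusD. Qed.

Lemma modulus_distC z w : modulus (z - w) = modulus (w - z).
Proof. by rewrite -modulusN opprB. Qed.

Lemma modulusR (r : R) : modulus (r%:C) = `|r|.
Proof. by rewrite /= expr0n /= addr0 sqrtr_sqr. Qed.

Lemma Re_le_modulus z : `|complex.Re z| <= modulus z.
Proof. by rewrite -lecR; exact: normc_ge_Re. Qed.

Lemma Im_le_modulus z : `|complex.Im z| <= modulus z.
Proof.
case: z => a b /=; rewrite -sqrtr_sqr ler_sqrt ?addr_ge0 ?sqr_ge0//.
by rewrite lerDr sqr_ge0.
Qed.

Lemma modulus_le_ReIm z : modulus z <= `|complex.Re z| + `|complex.Im z|.
Proof.
case: z => a b /=; rewrite -(ger0_norm (addr_ge0 (normr_ge0 a) (normr_ge0 b))).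
rewrite -sqrtr_sqr ler_sqrt ?sqr_ge0// sqrrD !real_normK ?num_real//.
by rewrite addrAC lerDl mulrn_wge0// mulr_ge0.
Qed.

End Modulus.

(** * Jets *)

Section Jets.
Variable R : realType.
Local Notation C := R[i].

(** A second-order expansion at 0 whose norm is at most [c]. The function [f2] is controlled only on
    the unit disc, and [B] is any bound for it there, so that no supremum has to be formed. *)
Definition jet (f : C -> C) (c : R) :=
  exists (f0 f1 : C) (f2 : C -> C) (B : R),
    [/\ forall h, f h = f0 + h * f1 + h ^+ 2 * f2 h,
        forall h, modulus h <= 1 -> modulus (f2 h) <= B &
        modulus f0 + modulus f1 + B <= c].

Lemma jet_ge0 f c : jet f c -> 0 <= c.
Proof.
move=> [f0 [f1 [f2 [B [_ fB]]]]]; apply: le_trans.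
rewrite !addr_ge0 ?modulus_ge0//.
by apply: le_trans (fB 0 _); rewrite ?modulus_ge0// modulus0.
Qed.

Lemma jet_le f c d : c <= d -> jet f c -> jet f d.
Proof.
move=> cd [f0 [f1 [f2 [B [fE fB fc]]]]]; exists f0, f1, f2, B; split => //.
exact: le_trans cd.
Qed.

Lemma jet_bound f c h : jet f c -> modulus h <= 1 -> modulus (f h) <= c.
Proof.
move=> [f0 [f1 [f2 [B [fE fB fc]]]]] h1; rewrite fE.
apply: le_trans fc; apply: le_trans (modulusD _ _) _; apply: lerD.
  apply: le_trans (modulusD _ _) _; rewrite lerD2l modulusM.
  by rewrite ler_piMl ?modulus_ge0.
rewrite modulusM modulusX; apply: le_trans (fB h h1).
by rewrite ler_piMl ?modulus_ge0// exprn_ile1// modulus_ge0.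
Qed.

Lemma jet_cst a : jet (fun=> a) (modulus a).
Proof.
exists a, 0, (fun=> 0), 0; split => [h|h _|]; last by rewrite modulus0 !addr0.
  by rewrite !mulr0 !addr0.
by rewrite modulus0.
Qed.

Lemma jet_affine a b : jet (fun h => a + h * b) (modulus a + modulus b).
Proof.
exists a, b, (fun=> 0), 0; split => [h|h _|]; last by rewrite !addr0.
  by rewrite !mulr0 !addr0.
by rewrite modulus0.
Qed.

Lemma jetD f g c d : jet f c -> jet g d -> jet (fun h => f h + g h) (c + d).
Proof.
move=> [f0 [f1 [f2 [B [fE fB fc]]]]] [g0 [g1 [g2 [D [gE gD gd]]]]].
exists (f0 + g0), (f1 + g1), (fun h => f2 h + g2 h), (B + D); split => [h|h h1|].
- by rewrite fE gE; ring.
- by apply: le_trans (modulusD _ _) _; apply: lerD; [exact: fB|exact: gD].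
- apply: le_trans (lerD fc gd).
  by have := modulusD f0 g0; have := modulusD f1 g1; lra.
Qed.

(** The remainder of the product collects all terms of degree at least 2; on the unit disc the
    surplus powers of [h] cost nothing. The bounds obtained are the nine terms of the expanded
    product of the two norms. *)
Lemma jetM f g c d : jet f c -> jet g d -> jet (fun h => f h * g h) (c * d).
Proof.
move=> jf jg; have c0 := jet_ge0 jf; have d0 := jet_ge0 jg.
move: jf jg => [f0 [f1 [f2 [B [fE fB fc]]]]] [g0 [g1 [g2 [D [gE gD gd]]]]].
have B0 : 0 <= B by apply: le_trans (fB 0 _); rewrite ?modulus_ge0// modulus0.
have D0 : 0 <= D by apply: le_trans (gD 0 _); rewrite ?modulus_ge0// modulus0.
exists (f0 * g0), (f0 * g1 + f1 * g0),
  (fun h => f0 * g2 h + f1 * g1 + f2 h * g0 + h * (f1 * g2 h + f2 h * g1)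
            + h ^+ 2 * (f2 h * g2 h)),
  (modulus f0 * D + modulus f1 * modulus g1 + B * modulus g0
   + (modulus f1 * D + B * modulus g1) + B * D); split => [h|h h1|].
- by rewrite fE gE; ring.
- have ml x : modulus (h * x) <= modulus x.
    by rewrite modulusM ler_piMl ?modulus_ge0.
  have f2B := fB h h1; have g2D := gD h h1.
  have le (u v : C) (a b : R) : modulus u <= a -> modulus v <= b ->
      modulus (u * v) <= a * b.
    by move=> ua vb; rewrite modulusM ler_pM ?modulus_ge0.
  do ![apply: le_trans (modulusD _ _) _; apply: lerD]; try exact: le.
    apply: le_trans (ml _) _; apply: le_trans (modulusD _ _) _.
    by apply: lerD; exact: le.
  rewrite expr2 -mulrA; apply: le_trans (ml _) _.
  by apply: le_trans (ml _) _; exact: le.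
- apply: (@le_trans _ _ ((modulus f0 + modulus f1 + B) *
                         (modulus g0 + modulus g1 + D))); last first.
    by apply: ler_pM => //; rewrite !addr_ge0 ?modulus_ge0.
  rewrite modulusM; have := modulusD (f0 * g1) (f1 * g0).
  by rewrite !modulusM; lra.
Qed.

(** The coefficients [f0] and [f1] cancel, and only [h * f2 h - k * f2 k] survives. *)
Lemma jet_slope f c h k : jet f c -> h != 0 -> k != 0 ->
  modulus h <= 1 -> modulus k <= 1 ->
  modulus (h^-1 * (f h - f 0) - k^-1 * (f k - f 0)) <=
  c * (modulus h + modulus k).
Proof.
move=> jf h0 k0 h1 k1; have c0 := jet_ge0 jf.
have [f0 [f1 [f2 [B [fE fB fc]]]]] := jf.
have Bc : B <= c.
  by apply: le_trans fc; rewrite lerDr addr_ge0 ?modulus_ge0.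
have -> : h^-1 * (f h - f 0) - k^-1 * (f k - f 0) = h * f2 h - k * f2 k.
  by rewrite !fE; field; rewrite h0 k0.
apply: le_trans (modulusB _ _) _; rewrite !modulusM mulrDr.
rewrite ![c * _]mulrC; apply: lerD; apply: ler_wpM2l; rewrite ?modulus_ge0//.
  exact: le_trans (fB _ _) Bc.
exact: le_trans (fB _ _) Bc.
Qed.

End Jets.

(** * Taylor estimate of order 2 for the complex exponential *)

Section ComplexExponential.
Variable R : realType.
Local Notation C := R[i].

(** Since [(i+3)! >= i!], the series from index 3 on is dominated by [|y|^3] times the exponential
    series of [|y|]. The exponential, the cosine and the sine are all instances. *)
Lemma series_tail3_le (u : R ^nat) (y : R) :
  (forall n, `|u n| <= `|y| ^+ n / n`!%:R) -> cvgn (series u) ->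
  `|limn (series u) - (u 0%N + u 1%N + u 2%N)| <= `|y| ^+ 3 * expR `|y|.
Proof.
move=> uy cu.
have c3 : (fun N => `|series u (N + 3)%N - (u 0%N + u 1%N + u 2%N)|) @ \oo -->
    `|limn (series u) - (u 0%N + u 1%N + u 2%N)|.
  apply: cvg_norm; apply: cvgB; last exact: cvg_cst.
  by move: cu; rewrite -(cvg_shiftn 3).
rewrite -(cvg_lim _ c3)//; apply: limr_le; first by apply/cvg_ex; eexists; exact: c3.
near=> N; rewrite seriesEnat/= addnC big_nat_recl//= big_nat_recl//= big_nat_recl//=.
rewrite !addrA [X in `|X|](_ : _ = \sum_(0 <= i < N) u i.+3); last by ring.
apply: le_trans (ler_norm_sum _ _ _) _.
apply: (@le_trans _ _ (`|y| ^+ 3 * series (exp_coeff `|y|) N)).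
  rewrite seriesEnat/= mulr_sumr; apply: ler_sum => i _.
  apply: le_trans (uy _) _; rewrite /exp_coeff/= mulrA -exprD ler_wpM2l ?exprn_ge0//.
  rewrite lef_pV2 ?posrE ?ltr0n ?fact_gt0// ler_nat.
  by rewrite leq_fact//; exact: (leq_addl 3 i).
rewrite ler_wpM2l ?exprn_ge0//.
apply: nondecreasing_cvgn_le; last exact: is_cvg_series_exp_coeff.
by apply: nondecreasing_series => i _ _; exact: exp_coeff_ge0.
Unshelve. all: by end_near. Qed.

Lemma expR_taylor2 (x : R) :
  `|expR x - (1 + x + x ^+ 2 / 2)| <= `|x| ^+ 3 * expR `|x|.
Proof.
have := @series_tail3_le (exp_coeff x) x.
rewrite /exp_coeff/= expr0 expr1 !divr1 (_ : 2`!%:R = 2)//; apply.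
- by move=> n; rewrite normrM normrX normfV normr_nat.
- exact: is_cvg_series_exp_coeff.
Qed.

Lemma cos_taylor2 (x : R) :
  `|cos x - (1 - x ^+ 2 / 2)| <= `|x| ^+ 3 * expR `|x|.
Proof.
have := @series_tail3_le (cos_coeff x) x.
rewrite cos.unlock /cos_coeff/= !expr0 !expr1 ?mul0r ?addr0 !divr1 (_ : 2`!%:R = 2)//.
rewrite !mul1r mulN1r mulNr; apply.
- move=> n; rewrite !normrM !normrX normfV normrN1 expr1n mulr1 !normr_nat.
  rewrite ler_wpM2r ?invr_ge0// ler_piMl ?exprn_ge0//.
  by case: (odd n).
- exact: is_cvg_series_cos_coeff.
Qed.

Lemma sin_taylor2 (x : R) : `|sin x - x| <= `|x| ^+ 3 * expR `|x|.
Proof.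
have := @series_tail3_le (sin_coeff x) x.
rewrite sin.unlock /sin_coeff/= !expr0 !expr1 ?mul0r ?addr0 ?add0r !divr1.
rewrite !mul1r; apply.
- move=> n; rewrite !normrM !normrX normfV normrN1 expr1n mulr1 !normr_nat.
  rewrite ler_wpM2r ?invr_ge0// ler_piMl ?exprn_ge0//.
  by case: (odd n).
- exact: is_cvg_series_sin_coeff.
Qed.

Lemma cexpD (z w : C) : cexp (z + w) = cexp z * cexp w.
Proof.
rewrite /cexp; case: z w => a b [c d] /=; rewrite expRD cosD sinD.
by apply/eqP; rewrite eq_complex/=; apply/andP; split; apply/eqP; ring.
Qed.

(** As [cexp] is given by its real and imaginary parts, the real Taylor estimates of [expR a],
    [cos b] and [sin b] are multiplied out in each part separately. *)
Lemma cexp_taylor2 (M : R) : 0 <= M -> exists2 K, 0 <= K &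
  forall t : C, modulus t <= M ->
    modulus (cexp t - (1 + t + t ^+ 2 / 2)) <= K * modulus t ^+ 3.
Proof.
move=> M0; set e := expR M; have e0 : 0 <= e by exact: expR_ge0.
pose P := 1 + M + M ^+ 2; have P0 : 0 <= P by rewrite !addr_ge0 ?exprn_ge0.
(* Equal contributions of the real and the imaginary part. In each, [e] comes from the remainder of
   [expR a], [P * e] from that of [cos b] or [sin b] multiplied by the polynomial [A], and [1 + M]
   from the leftover monomials. *)
exists ((e + P * e + (1 + M)) + (e + P * e + (1 + M))) => [|t tM].
  by rewrite !addr_ge0 ?mulr_ge0.
move: (modulus_ge0 t) (Re_le_modulus t) (Im_le_modulus t) tM.
move: (modulus t) => m; case: t => a b m0.
rewrite [complex.Re _]/= [complex.Im _]/= => am bm mM.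
pose A := 1 + a + a ^+ 2 / 2.
have am2 : `|a| ^+ 2 <= m ^+ 2 by rewrite lerXn2r ?nnegrE.
have bm2 : `|b| ^+ 2 <= m ^+ 2 by rewrite lerXn2r ?nnegrE.
have mM2 : m ^+ 2 <= M ^+ 2 by rewrite lerXn2r ?nnegrE.
have AP : `|A| <= P.
  apply: le_trans (ler_normD _ _) _; apply: lerD.
    by apply: le_trans (ler_normD _ _) _; rewrite normr1 lerD2l (le_trans am).
  rewrite normrM normrX normfV normr_nat; have := exprn_ge0 2 (normr_ge0 a); lra.
have taylor (u v : R) :
    `|v| <= m -> `|u| <= `|v| ^+ 3 * expR `|v| -> `|u| <= e * m ^+ 3.
  move=> vm /le_trans; apply; rewrite mulrC ler_pM ?expR_ge0 ?exprn_ge0//.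
    by rewrite ler_expR (le_trans vm).
  by rewrite lerXn2r ?nnegrE.
have split3 (u c v w : R) : `|u| <= e * m ^+ 3 -> `|c| <= 1 ->
    `|v| <= e * m ^+ 3 -> `|w| <= (1 + M) * m ^+ 3 ->
    `|u * c + A * v + w| <= (e + P * e + (1 + M)) * m ^+ 3.
  move=> ul cl vl wl; have -> : (e + P * e + (1 + M)) * m ^+ 3 =
      e * m ^+ 3 + P * (e * m ^+ 3) + (1 + M) * m ^+ 3 by ring.
  apply: le_trans (ler_normD _ _) _; apply: lerD => //.
  apply: le_trans (ler_normD _ _) _; rewrite !normrM; apply: lerD.
    by rewrite -[leRHS]mulr1 ler_pM.
  by rewrite ler_pM.
have hcos : `|cos b| <= 1 by rewrite ler_norml cos_geN1 cos_le1.
have hsin : `|sin b| <= 1 by rewrite ler_norml sin_geN1 sin_le1.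
have m3 : m ^+ 3 = m * m ^+ 2 by rewrite exprS.
have ea := taylor _ _ am (expR_taylor2 a).
have cb := taylor _ _ bm (cos_taylor2 b).
have sb := taylor _ _ bm (sin_taylor2 b).
rewrite [leRHS]mulrDl.
have half : (2 : C)^-1 = (2^-1)%:C by rewrite fmorphV rmorph_nat.
apply: le_trans (modulus_le_ReIm _) _; rewrite half; apply: lerD => /=.
  (* These monomials are [A * (1 - b^2/2)] minus the real part of [1 + t + t^2/2]. *)
  have w : `|- (a * b ^+ 2 / 2 + (a * a) * b ^+ 2 / 4)| <= (1 + M) * m ^+ 3.
    rewrite normrN mulrDl; apply: le_trans (ler_normD _ _) _.
    rewrite !(normrX, normrM) !normfV !normr_nat mul1r m3; apply: lerD.
      rewrite ler_pdivrMr// -[leLHS]mulr1 ler_pM ?mulr_ge0 ?exprn_ge0// ?ler1n//.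
      by rewrite ler_pM ?exprn_ge0.
    rewrite ler_pdivrMr// -[leLHS]mulr1 ler_pM ?mulr_ge0 ?exprn_ge0// ?ler1n//.
    rewrite [leRHS]mulrA; apply: (@ler_pM _ (`|a| * `|a|)); rewrite ?mulr_ge0 ?exprn_ge0//.
    by apply: ler_pM => //; exact: le_trans am mM.
  rewrite [X in `|X|](_ : _ =
    (expR a - A) * cos b + A * (cos b - (1 - b ^+ 2 / 2))
    + - (a * b ^+ 2 / 2 + (a * a) * b ^+ 2 / 4)); first exact: split3.
  by rewrite /A; field.
have w : `|a ^+ 2 * b / 2| <= (1 + M) * m ^+ 3.
  rewrite !(normrX, normrM) !normfV normr_nat m3 ler_pdivrMr// -[leLHS]mulr1.
  rewrite ler_pM ?mulr_ge0 ?exprn_ge0// ?ler1n// mulrC.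
  rewrite -[leLHS]mul1r; apply: ler_pM; rewrite ?mulr_ge0 ?exprn_ge0 ?lerDl//.
  by apply: (@ler_pM _ `|b|); rewrite ?exprn_ge0.
rewrite [X in `|X|](_ : _ = (expR a - A) * sin b + A * (sin b - b)
    + a ^+ 2 * b / 2); first exact: split3.
by rewrite /A; field.
Qed.
End ComplexExponential.

(** * Orders of families of jets, up to the elementary factors *)

Section JetFamilies.
Variable R : realType.
Local Notation C := R[i].

Lemma jet_at0 (f : C -> C) c : jet f c -> jet (fun=> f 0) c.
Proof.
by move=> jf; apply: jet_le (jet_cst _); apply: (jet_bound jf); rewrite modulus0.
Qed.

Lemma jet_sub0 (f : C -> C) c : jet f c ->
  jet (fun h => f h - f 0) c /\
  forall h, modulus h <= 1 -> modulus (f h - f 0) <= modulus h * c.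
Proof.
move=> [f0 [f1 [f2 [B [fE fB fc]]]]].
have fsub h : f h - f 0 = 0 + h * f1 + h ^+ 2 * f2 h by rewrite !fE; ring.
split => [|h h1].
  exists 0, f1, f2, B; split=> //; rewrite modulus0 add0r; apply: le_trans fc.
  by rewrite lerD2r lerDr modulus_ge0.
rewrite fsub add0r expr2 -mulrA -mulrDr modulusM ler_wpM2l ?modulus_ge0//.
apply: le_trans fc; rewrite -addrA; apply: le_trans (modulusD _ _) _.
apply: ler_wpDl; first exact: modulus_ge0.
rewrite lerD2l modulusM; apply: le_trans (fB h h1).
by rewrite ler_piMl ?modulus_ge0.
Qed.

(* [r (f h - f 0)] is divisible by [h^2] because [r] vanishes to third order. *)
Lemma jet_cubic_remainder (r f : C -> C) (K M c : R) :
  0 <= K -> (forall t, modulus t <= M -> modulus (r t) <= K * modulus t ^+ 3) ->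
  c <= M -> jet f c -> jet (fun h => r (f h - f 0)) (K * c ^+ 3).
Proof.
move=> K0 rK cM jf; have c0 := jet_ge0 jf; have [_ fh] := jet_sub0 jf.
have r0 : r 0 = 0.
  apply/eqP; rewrite -modulus_eq0 eq_le modulus_ge0 andbT.
  by apply: le_trans (rK _ _) _; rewrite modulus0 ?expr0n ?mulr0// (le_trans c0).
(* The division does no harm at [h = 0]: as [r 0 = 0], both the left-hand side of the expansion and
   the quotient vanish there. *)
exists 0, 0, (fun h => r (f h - f 0) / h ^+ 2), (K * c ^+ 3); split => [h|h h1|].
- have [->|h0] := eqVneq h 0; first by rewrite subrr r0; ring.
  by field.
- have [->|h0] := eqVneq h 0.
    by rewrite subrr r0 mul0r modulus0 mulr_ge0 ?exprn_ge0.
  have hp := modulus_gt0 h0.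
  rewrite modulusM modulusV modulusX ler_pdivrMr ?exprn_gt0//.
  have fc : modulus (f h - f 0) <= c.
    by apply: le_trans (fh h h1) _; rewrite ler_piMl.
  apply: le_trans (rK _ (le_trans fc cM)) _; rewrite -mulrA ler_wpM2l//.
  apply: (@le_trans _ _ ((modulus h * c) ^+ 3)).
    by rewrite lerXn2r ?nnegrE ?mulr_ge0 ?modulus_ge0//; exact: fh.
  rewrite exprMn mulrC ler_wpM2l ?exprn_ge0//.
  by rewrite ler_wiXn2l ?modulus_ge0.
- by rewrite modulus0 !add0r.
Qed.

Variables (I : Type) (S : set I) (c : I -> R) (M : R).
Hypothesis c_ge0 : forall i, S i -> 0 <= c i.
Hypothesis c_leM : forall i, S i -> c i <= M.
Implicit Types f g : I -> C -> C.

(** A big-O in the norm of jets: order [c i ^+ k], with one constant [K] for all [i] in [S], so that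
    the bounds can later be summed over [i]. *)
Definition jetO (k : nat) f :=
  exists2 K, 0 <= K & forall i, S i -> jet (f i) (K * c i ^+ k).

Lemma jetO_ext k f g : (forall i h, f i h = g i h) -> jetO k f -> jetO k g.
Proof. by move=> fg; suff -> : f = g by []; apply/funext => i; exact/funext. Qed.

Lemma jetO_cst a : jetO 0 (fun _ _ => a).
Proof.
exists (modulus a) => [|i Si]; first exact: modulus_ge0.
by rewrite expr0 mulr1; exact: jet_cst.
Qed.

Lemma jetOD k f g : jetO k f -> jetO k g -> jetO k (fun i h => f i h + g i h).
Proof.
move=> [K K0 fK] [L L0 gL]; exists (K + L) => [|i Si]; first exact: addr_ge0.
by rewrite mulrDl; apply: jetD; [exact: fK|exact: gL].
Qed.

Lemma jetOM k l f g :
  jetO k f -> jetO l g -> jetO (k + l) (fun i h => f i h * g i h).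
Proof.
move=> [K K0 fK] [L L0 gL]; exists (K * L) => [|i Si]; first exact: mulr_ge0.
by rewrite exprD mulrACA; apply: jetM; [exact: fK|exact: gL].
Qed.

Lemma jetOZ k a f : jetO k f -> jetO k (fun i h => a * f i h).
Proof. by move=> fk; have := jetOM (jetO_cst a) fk; rewrite add0n. Qed.

(** As [c] is bounded, surplus powers of it go into the constant. The bound is taken as [|M|]
    because [M] may be negative when [S] is empty. *)
Lemma jetO_weaken k l f : (k <= l)%N -> jetO l f -> jetO k f.
Proof.
move=> kl [K K0 fK]; exists (K * `|M| ^+ (l - k)) => [|i Si].
  by rewrite mulr_ge0 ?exprn_ge0.
apply: jet_le (fK i Si); rewrite -[leRHS]mulrA -{1}(subnK kl) exprD.
rewrite ler_wpM2l// ler_wpM2r ?exprn_ge0 ?c_ge0//.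
by rewrite lerXn2r ?nnegrE ?c_ge0// (le_trans (c_leM Si)) ?ler_norm.
Qed.

Lemma jetOX k n f : jetO k f -> jetO (n * k) (fun i h => f i h ^+ n).
Proof.
move=> fk; elim: n => [|n IH]; first exact: (jetO_cst 1).
by rewrite mulSn; apply: jetO_ext (jetOM fk IH) => i h; rewrite exprS.
Qed.

Lemma jetO_sum k (J : eqType) (r : seq J) (F : J -> I -> C -> C) :
  (forall j, j \in r -> jetO k (F j)) -> jetO k (fun i h => \sum_(j <- r) F j i h).
Proof.
elim: r => [|j r IH] Fk.
  apply: (@jetO_ext k (fun _ _ => 0)) => [i h|]; first by rewrite big_nil.
  by exists 0 => // i Si; rewrite mul0r -(@modulus0 R); exact: jet_cst.
apply: (@jetO_ext k (fun i h => F j i h + \sum_(j <- r) F j i h)) => [i h|].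
  by rewrite big_cons.
apply: jetOD; first by apply: Fk; rewrite mem_head.
by apply: IH => l lr; apply: Fk; rewrite in_cons lr orbT.
Qed.

(** The Taylor estimate bounds only the modulus of the remainder [rem], which says nothing about the
    jet of [rem (s i h)] directly. So [s] is split into its value [s0] at [h = 0] and the increment
    [t]: [rem s0] is constant in [h], [rem t] falls under [jet_cubic_remainder], and [cexpD]
    recombines the two. *)
Lemma jetO_cexp s : jetO 1 s ->
  jetO 3 (fun i h => cexp (s i h) - (1 + s i h + s i h ^+ 2 / 2)).
Proof.
move=> sO; have [K K0 sK] := sO.
pose rem (t : C) := cexp t - (1 + t + t ^+ 2 / 2).
have [L L0 remL] := cexp_taylor2 (mulr_ge0 K0 (normr_ge0 M)).
have sM i : S i -> K * c i <= K * `|M|.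
  by move=> Si; rewrite ler_wpM2l// (le_trans (c_leM Si)) ?ler_norm.
have sK' i : S i -> jet (s i) (K * c i) by move=> Si; rewrite -(expr1 (c i)); exact: sK.
pose s0 i (h : C) := s i 0; pose t i h := s i h - s i 0.
have s0O : jetO 1 s0.
  by exists K => // i Si; rewrite expr1; apply: jet_at0; exact: sK'.
have tO : jetO 1 t.
  by exists K => // i Si; rewrite expr1; apply: (jet_sub0 _).1; exact: sK'.
have r0O : jetO 3 (fun i h => rem (s0 i h)).
  exists (L * K ^+ 3) => [|i Si]; first by rewrite mulr_ge0 ?exprn_ge0.
  rewrite -mulrA -exprMn; apply: jet_le (jet_cst (rem (s i 0))).
  have sb : modulus (s i 0) <= K * c i by apply: (jet_bound (sK' i Si)); rewrite modulus0.
  apply: le_trans (remL _ (le_trans sb (sM i Si))) _; rewrite ler_wpM2l//.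
  by rewrite lerXn2r ?nnegrE ?modulus_ge0 ?mulr_ge0 ?c_ge0.
have rtO : jetO 3 (fun i h => rem (t i h)).
  exists (L * K ^+ 3) => [|i Si]; first by rewrite mulr_ge0 ?exprn_ge0.
  rewrite -mulrA -exprMn.
  exact: (jet_cubic_remainder (r := rem) (f := s i) L0 remL (sM i Si) (sK' i Si)).
have P2O (u : I -> C -> C) : jetO 1 u -> jetO 0 (fun i h => 1 + u i h + u i h ^+ 2 / 2).
  move=> uO; apply: jetOD.
    by apply: jetOD; [exact: jetO_cst|exact: jetO_weaken uO].
  have := jetOZ 2^-1 (jetOX 2 uO); under eq_fun do under eq_fun do rewrite mulrC.
  exact: jetO_weaken.
(* [F/2 + G/2 + H/4] is the product of the quadratic polynomials of [s0] and [t] minus the quadratic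
   polynomial of [s0 + t]. *)
pose F i h := s0 i h * t i h ^+ 2.
have FO : jetO 3 F by exact: (jetOM (k:=1) (l:=2) s0O (jetOX 2 tO)).
pose G i h := s0 i h ^+ 2 * t i h.
have GO : jetO 3 G by exact: (jetOM (k:=2) (l:=1) (jetOX 2 s0O) tO).
pose H i h := s0 i h ^+ 2 * t i h ^+ 2.
have HO : jetO 3 H.
  by apply: (@jetO_weaken 3 4) => //; exact: (jetOM (k:=2) (l:=2) (jetOX 2 s0O) (jetOX 2 tO)).
have := jetOD (jetOD (jetOD (jetOZ 2^-1 FO) (jetOZ 2^-1 GO)) (jetOZ 4^-1 HO))
  (jetOD (jetOM r0O (P2O _ tO)) (jetOM (jetOD (P2O _ s0O) (jetO_weaken (leq0n 3) r0O)) rtO)).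
apply: jetO_ext => i h.
have -> : s i h = s0 i h + t i h by rewrite /s0 /t; ring.
by rewrite cexpD /F /G /H /rem; field.
Qed.

(* Writing [s] for the exponent and [T] for its part of degree at least 3, [E_p(w) - 1]
   is [- w^3 + (1 - w) (w^3/2 + w^4/8 + T (1 + w + w^2/2) + T^2/2 + O(s^3))]. *)
Lemma jetO_elementary_factor p w : (2 <= p)%N -> jetO 1 w ->
  jetO 3 (fun i h => elementary_factor p (w i h) - 1).
Proof.
move=> p2 wO.
pose T i h := \sum_(3 <= k < p.+1) w i h ^+ k / k%:R.
have TO : jetO 3 T.
  apply: jetO_sum => k; rewrite mem_index_iota => /andP[k3 _].
  apply: (@jetO_ext 3 (fun i h => k%:R^-1 * w i h ^+ k)) => [i h|].
    by rewrite mulrC.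
  by apply: jetO_weaken k3 _; rewrite -[k in jetO k]muln1; exact/jetOZ/jetOX.
pose s i h := \sum_(1 <= k < p.+1) w i h ^+ k / k%:R.
(* Here [p >= 2] enters: the exponent begins with [w + w^2/2], which makes the terms of degree 1 and
   2 of the factor cancel. *)
have sE i h : s i h = w i h + w i h ^+ 2 / 2 + T i h.
  by rewrite /s big_ltn ?ltnS ?(ltnW p2)// big_ltn ?ltnS// expr1 divr1 addrA.
have w0 : jetO 0 w by exact: jetO_weaken wO.
have w2 := jetOX 2 wO.
have sO : jetO 1 s.
  apply: (@jetO_ext 1 (fun i h => w i h + 2^-1 * w i h ^+ 2 + T i h)) => [i h|].
    by rewrite sE; congr (_ + _ + _); rewrite mulrC.
  apply: jetOD; last exact: jetO_weaken TO.
  by apply: jetOD => //; apply: jetOZ; exact: jetO_weaken w2.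
pose rem (t : C) := cexp t - (1 + t + t ^+ 2 / 2).
have rO : jetO 3 (fun i h => rem (s i h)) by exact: jetO_cexp.
have w3 : jetO 3 (fun i h => w i h ^+ 3) := jetOX 3 wO.
have w4 : jetO 3 (fun i h => w i h ^+ 4) by exact: jetO_weaken (jetOX 4 wO).
have q0 : jetO 0 (fun i h => 1 + w i h + 2^-1 * w i h ^+ 2).
  apply: jetOD; first by apply: jetOD => //; exact: jetO_cst.
  by apply: jetOZ; exact: jetO_weaken w2.
have T2 : jetO 3 (fun i h => T i h * T i h).
  by apply: jetO_weaken (jetOM TO TO).
have u0 : jetO 0 (fun i h => 1 + -1 * w i h).
  by apply: jetOD; [exact: jetO_cst|exact: jetOZ].
have := jetOD (jetOZ (-1) w3) (jetOM u0 (jetOD (jetOD (jetOD (jetOD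
  (jetOZ 2^-1 w3) (jetOZ 8^-1 w4)) (jetOM TO q0)) (jetOZ 2^-1 T2)) rO)).
apply: jetO_ext => i h; rewrite /elementary_factor -/(s i h) /rem sE.
by set e := cexp _; field.
Qed.

End JetFamilies.

(** * Convergence and compactness in the complex plane *)

Section ComplexTopology.
Variable R : realType.
Local Notation C := R[i].

(** A positive element of [R[i]] has imaginary part 0, so quantifying over real [e] loses
    nothing. *)
Lemma complex_cvgP (G : set_system C) (l : C) {FG : Filter G} :
  (G --> l) <-> (forall e : R, 0 < e -> G [set w | modulus (l - w) < e]).
Proof.
split => [Gl e e0|Gl].
  have e0C : 0 < e%:C by rewrite ltcR.
  have lt_modulus w : `|l - w| < e%:C -> modulus (l - w) < e by rewrite -ltcR.
  exact: filterS lt_modulus ((@cvgrPdist_lt _ _ _ G _ id l).1 Gl _ e0C).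
apply/(@cvgrPdist_lt _ _ _ G _ id l) => -[e e']; rewrite ltcE => /andP[/eqP /= -> e0].
have lt_modulus w : modulus (l - w) < e -> `|l - w| < e%:C by rewrite -ltcR.
exact: filterS lt_modulus (Gl e e0).
Qed.

Lemma complex_cvg_lincomb (J : Type) (G : set_system J) (FG : Filter G)
    (c d : C) (u v : J -> C) (a b : C) : u @ G --> a -> v @ G --> b ->
  (fun j => c * u j + d * v j) @ G --> c * a + d * b.
Proof.
move=> ua vb; apply/complex_cvgP => e e0.
have K0 : 0 < modulus c + modulus d + 1.
  by rewrite ltr_wpDl// addr_ge0 ?modulus_ge0.
have e1 : 0 < e / (modulus c + modulus d + 1) by rewrite divr_gt0.
have Gu : G [set j | modulus (a - u j) < e / (modulus c + modulus d + 1)].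
  exact: (complex_cvgP a).1 ua _ e1.
have Gv : G [set j | modulus (b - v j) < e / (modulus c + modulus d + 1)].
  exact: (complex_cvgP b).1 vb _ e1.
apply: (@filterS2 _ G FG _ _ _ _ Gu Gv) => j uj vj.
suff : modulus (c * a + d * b - (c * u j + d * v j)) < e by [].
rewrite (_ : c * a + d * b - _ = c * (a - u j) + d * (b - v j)); last by ring.
apply: (le_lt_trans (modulusD _ _)); rewrite !modulusM.
apply: (@le_lt_trans _ _ ((modulus c + modulus d) * (e / (modulus c + modulus d + 1)))).
  by rewrite mulrDl; apply: lerD; rewrite ler_wpM2l ?modulus_ge0// ltW.
by rewrite mulrCA -ltr_pdivlMl// mulVf ?gt_eqF// ltr_pdivrMr// mul1r ltrDl.
Qed.

(** The real and imaginary parts are 1-Lipschitz, so their images of [G] are Cauchy and the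
    completeness of [R] applies to each. *)
Lemma complex_cauchy_cvg (G : set_system C) : ProperFilter G ->
  (forall e : R, 0 < e -> exists z, G [set w | modulus (z - w) < e]) ->
  cvg G.
Proof.
move=> FG Gc.
have cvg_part (f : C -> R) : (forall z w, `|f z - f w| <= modulus (z - w)) ->
    cvg (f @ G).
  move=> flip; apply: cauchy_cvg; apply: cauchy_exP => e e0.
  have [z Gz] := Gc e e0; exists (f z).
  apply: (@filterS _ G _ [set w | modulus (z - w) < e]) => // w zw.
  exact: (le_lt_trans (flip z w) zw).
have reG := cvg_part (@complex.Re R)
  (fun z w => ltac:(rewrite -raddfB; exact: Re_le_modulus)).
have imG := cvg_part (@complex.Im R)
  (fun z w => ltac:(rewrite -raddfB; exact: Im_le_modulus)).
apply/cvg_ex; exists (lim (@complex.Re R @ G) +i* lim (@complex.Im R @ G)).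
apply/complex_cvgP => e e0; have e2 : 0 < e / 2 by rewrite divr_gt0.
have reb : G [set w | `|lim (@complex.Re R @ G) - complex.Re w| < e / 2].
  exact: (cvgrPdist_lt _ _).1 reG _ e2.
have imb : G [set w | `|lim (@complex.Im R @ G) - complex.Im w| < e / 2].
  exact: (cvgrPdist_lt _ _).1 imG _ e2.
apply: (@filterS2 _ G _ _ _ _ _ reb imb) => -[a b] ha hb.
by apply: le_lt_trans (modulus_le_ReIm _) _; rewrite (splitr e); exact: ltrD.
Qed.

Lemma complex_re_continuous : continuous (@complex.Re R : C -> R).
Proof.
move=> z; have FG : Filter (nbhs z) by exact: nbhs_filter.
apply/(@cvgrPdist_lt _ _ _ (nbhs z) FG (@complex.Re R)) => e e0.
have zG := (@complex_cvgP (nbhs z) z FG).1 (fun A => id) e e0.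
apply: (@filterS _ (nbhs z) FG _ _ _ zG) => w; apply: le_lt_trans.
by rewrite -raddfB; exact: Re_le_modulus.
Qed.

Lemma complex_im_continuous : continuous (@complex.Im R : C -> R).
Proof.
move=> z; have FG : Filter (nbhs z) by exact: nbhs_filter.
apply/(@cvgrPdist_lt _ _ _ (nbhs z) FG (@complex.Im R)) => e e0.
have zG := (@complex_cvgP (nbhs z) z FG).1 (fun A => id) e e0.
apply: (@filterS _ (nbhs z) FG _ _ _ zG) => w; apply: le_lt_trans.
by rewrite -raddfB; exact: Im_le_modulus.
Qed.

Lemma complex_of_pair_continuous : continuous (@complex_of_pair R : R * R -> C).
Proof.
move=> [a b]; apply/complex_cvgP => e e0; have e2 : 0 < e / 2 by rewrite divr_gt0.
exists (ball a (e / 2), ball b (e / 2)); first by split; exact: nbhsx_ballx.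
move=> [x y] [ax bx]; apply: (le_lt_trans (modulus_le_ReIm _)).
by rewrite (splitr e); exact: ltrD.
Qed.

Lemma complex_square_compact (r : R) :
  compact [set z : C | `|complex.Re z| <= r /\ `|complex.Im z| <= r].
Proof.
rewrite (_ : [set _ | _] = @complex_of_pair R @` (`[-r, r]%classic `*` `[-r, r]%classic)).
  apply: continuous_compact; last first.
    exact: (compact_setX (@segment_compact _ _ _) (@segment_compact _ _ _)).
  by apply: continuous_subspaceT; exact: complex_of_pair_continuous.
apply/seteqP; split=> [[a b] /= [ar br]|z [[a b] [/= ar br] <-]].
  by exists (a, b) => //=; rewrite !in_itv/= -!ler_norml.
by move: ar br; rewrite !in_itv/= -!ler_norml.
Qed.

End ComplexTopology.

(** * Unordered products *)

Section JetProducts.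
Variable R : realType.
Local Notation C := R[i].

(** With the distance to 1 measured as [expR a - 1], the exponents add up under products, since
    [(1 + u)(1 + v) - 1 = u v + u + v]. Products are thereby controlled by sums. *)
Lemma jet1_mul (f g : C -> C) (a b : R) :
  jet (fun h => f h - 1) (expR a - 1) -> jet (fun h => g h - 1) (expR b - 1) ->
  jet (fun h => f h * g h - 1) (expR (a + b) - 1).
Proof.
move=> fa gb.
rewrite (_ : expR _ - 1 =
  (expR a - 1) * (expR b - 1) + (expR a - 1) + (expR b - 1)); last first.
  by rewrite expRD; ring.
rewrite (_ : (fun h => _) =
  (fun h => (f h - 1) * (g h - 1) + (f h - 1) + (g h - 1))); last first.
  by apply/funext => h; ring.
by apply: jetD => //; apply: jetD => //; exact: jetM.
Qed.

Lemma jet1_one : jet (fun=> 1 - 1 : C) (expR 0 - 1).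
Proof. by rewrite expR0 !subrr -(@modulus0 R); exact: jet_cst. Qed.

Lemma jet1X (f : C -> C) (a : R) n : jet (fun h => f h - 1) (expR a - 1) ->
  jet (fun h => f h ^+ n - 1) (expR (n%:R * a) - 1).
Proof.
move=> fa; elim: n => [|n IH]; first by rewrite mul0r; exact: jet1_one.
rewrite mulrS mulrDl mul1r; have := jet1_mul fa IH.
by under eq_fun do rewrite -exprS.
Qed.

Lemma jet1_prod (J : Type) (r : seq J) (P : pred J) (F : J -> C -> C) (b : J -> R) :
  (forall j, P j -> jet (fun h => F j h - 1) (expR (b j) - 1)) ->
  jet (fun h => \prod_(j <- r | P j) F j h - 1)
      (expR (\sum_(j <- r | P j) b j) - 1).
Proof.
move=> Fb; elim: r => [|j r IH].
  by rewrite big_nil; under eq_fun do rewrite big_nil; exact: jet1_one.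
rewrite big_cons; under eq_fun do rewrite big_cons.
by case: ifPn => // Pj; apply: jet1_mul => //; exact: Fb.
Qed.

End JetProducts.

Section UnorderedJetProducts.
Variables (R : realType) (I : choiceType) (S : set I) (g : I -> R[i] -> R[i]).
Variables (b : I -> R) (A : R).
Local Notation C := R[i].
Hypothesis g_jet : forall i, S i -> jet (fun h => g i h - 1) (expR (b i) - 1).
Hypothesis sum_b_le : forall F : {fset I}, \sum_(i <- F | i \in S) b i <= A.

Let P h F := partial_prod S (g ^~ h) F.
Let s (F : {fset I}) := \sum_(i <- F | i \in S) b i.

Lemma big_fset_split (T : Type) (idx : T) (op : Monoid.com_law idx)
    (Q : pred I) (f : I -> T) (F0 F : {fset I}) : (F0 `<=` F)%fset ->
  \big[op/idx]_(i <- F | Q i) f i =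
  op (\big[op/idx]_(i <- F0 | Q i) f i) (\big[op/idx]_(i <- (F `\` F0)%fset | Q i) f i).
Proof.
move=> F0F; rewrite -big_cat; apply: perm_big; apply: uniq_perm => //.
  rewrite cat_uniq !fset_uniq andbT /=; apply/hasPn => i.
  by rewrite in_fsetD => /andP[].
move=> i; rewrite mem_cat in_fsetD; have [iF0|//] := boolP (i \in F0).
by rewrite (fsubsetP F0F).
Qed.

Lemma partial_prod_jet F :
  jet (fun h => P h F - 1) (expR (s F) - 1).
Proof. by apply: jet1_prod => i /set_mem; exact: g_jet. Qed.

(** Take [F0] whose sum is within [e] of the supremum of all finite sums; adding further indices
    cannot exceed that supremum. *)
Lemma summable_tail e : 0 < e -> exists F0 : {fset I}, forall F : {fset I},
  (F0 `<=` F)%fset -> s (F `\` F0)%fset < e.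
Proof.
move=> e0; have hs : has_sup (range s).
  by split; [exists (s fset0); exists fset0|exists A => _ [F _ <-]; exact: sum_b_le].
have [_ [F0 _ <-] lt] := sup_adherent e0 hs; exists F0 => F F0F.
have : s F <= sup (range s) by apply: ub_le_sup; [exact: hs.2|exists F].
have -> : s F = s F0 + s (F `\` F0)%fset by exact: big_fset_split.
lra.
Qed.

Lemma partial_prod_cvg h : modulus h <= 1 -> cvg (P h @ summability.totally).
Proof.
have TF := @summability.totally_filter I.
move=> h1; apply: complex_cauchy_cvg => e e0.
have eA : 0 < e / expR A by rewrite divr_gt0 ?expR_gt0.
(* With this tail, the factors outside [F0] multiply to within [e / expR A] of 1, while the product
   over [F0] has modulus at most [expR A]. *)
have lne : 0 < ln (1 + e / expR A) by apply: ln_gt0; rewrite ltrDl.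
have [F0 F0s] := summable_tail lne; exists (P h F0), F0 => // F /= F0F.
have -> : P h F = P h F0 * P h (F `\` F0)%fset by exact: big_fset_split.
rewrite modulus_distC -{2}(mulr1 (P h F0)) -mulrBr modulusM.
have PA : modulus (P h F0) <= expR A.
  rewrite -(subrK 1 (P h F0)); apply: le_trans (modulusD _ _) _.
  rewrite modulus1 -lerBrDr; apply: le_trans (jet_bound (partial_prod_jet F0) h1) _.
  by rewrite lerB// ler_expR; exact: sum_b_le.
have Pe : modulus (P h (F `\` F0)%fset - 1) < e / expR A.
  apply: le_lt_trans (jet_bound (partial_prod_jet _) h1) _.
  by rewrite ltrBlDl -[ltRHS]lnK ?posrE ?addr_gt0// ltr_expR; exact: F0s.
apply: (@le_lt_trans _ _ (expR A * modulus (P h (F `\` F0)%fset - 1))).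
  by rewrite ler_wpM2r ?modulus_ge0.
by rewrite mulrC -ltr_pdivlMr ?expR_gt0.
Qed.

Lemma dist_lim_le (J : Type) (G : set_system J) (u : J -> C) (a l : C) (B : R) :
  ProperFilter G -> (forall j, modulus (u j - a) <= B) -> u @ G --> l ->
  modulus (l - a) <= B.
Proof.
move=> FG uB ul; apply/ler_addgt0Pr => e e0.
have [j /= lj] := @filter_ex _ G FG _ ((complex_cvgP l).1 ul e e0).
rewrite -(subrK (u j) l) -addrA addrC; apply: le_trans (modulusD _ _) _.
by apply: lerD => //; exact: ltW.
Qed.

Lemma unordered_prod_cvg h : modulus h <= 1 ->
  P h @ summability.totally --> unordered_prod S (g ^~ h).
Proof. exact: partial_prod_cvg. Qed.

Lemma unordered_prod_slope_cvg :
  cvg (h^-1 * (unordered_prod S (g ^~ h) - unordered_prod S (g ^~ 0))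
       @[h --> (0 : C)^']).
Proof.
set L := fun h => unordered_prod S (g ^~ h).
pose B := expR A - 1.
have B0 : 0 <= B.
  rewrite subr_ge0 -expR0 ler_expR; have := sum_b_le fset0.
  by rewrite big1_seq// => i; rewrite in_fset0 andbF.
have TF := @summability.totally_filter I.
have slope h k : h != 0 -> k != 0 -> modulus h <= 1 -> modulus k <= 1 ->
    modulus (h^-1 * (L h - L 0) - k^-1 * (L k - L 0)) <= B * (modulus h + modulus k).
  move=> h0 k0 h1 k1.
  rewrite -[X in modulus X]subr0; apply: (@dist_lim_le _ summability.totally
    (fun F => h^-1 * (P h F - P 0 F) - k^-1 * (P k F - P 0 F))) => [F|].
    have jF : jet (fun h => P h F - 1) B.
      by apply: jet_le (partial_prod_jet F); rewrite lerB// ler_expR; exact: sum_b_le.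
    have := jet_slope jF h0 k0 h1 k1.
    by rewrite subr0 !opprB !addrA !subrK.
  have c0 : P 0 @ summability.totally --> L 0.
    by apply: unordered_prod_cvg; rewrite modulus0.
  (* The difference of two slopes is a linear combination of the partial products at [h], [k] and 0,
     so it passes to the limit. *)
  rewrite (_ : (fun F => _) = (fun F =>
      1 * (h^-1 * P h F + - k^-1 * P k F) + (k^-1 - h^-1) * P 0 F)); last first.
    by apply/funext => F; ring.
  rewrite [X in _ --> X](_ : _ =
      1 * (h^-1 * L h + - k^-1 * L k) + (k^-1 - h^-1) * L 0); last by ring.
  apply: complex_cvg_lincomb c0.
  by apply: complex_cvg_lincomb; exact: unordered_prod_cvg.
apply: complex_cauchy_cvg => e e0.
(* For [|h| < d] the slopes at [h] and at the real point [d] differ by at most [2 B d], which is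
   below [e]; the slope at [d] serves as the centre in the Cauchy criterion. *)
pose d := Num.min 1 (e / (2 * (B + 1))).
have d0 : 0 < d by rewrite lt_min ltr01 divr_gt0// mulr_gt0// ltr_wpDl.
have d1 : d <= 1 by rewrite ge_min lexx.
exists ((d%:C)^-1 * (L d%:C - L 0)).
have dC : modulus d%:C = d by rewrite modulusR gtr0_norm.
have F0 : Filter (nbhs (0 : C)) by exact: nbhs_filter.
have nd := (@complex_cvgP _ (nbhs 0) 0 F0).1 (fun A => id) d d0.
apply: (@filterS _ (nbhs (0 : C)) F0 _ _ _ nd) => h /=.
rewrite sub0r modulusN => hd h0; apply: le_lt_trans (slope _ _ _ _ _ _) _ => //.
- by rewrite -modulus_eq0 dC gt_eqF.
- by rewrite dC.
- exact: le_trans (ltW hd) d1.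
- rewrite dC; apply: (@le_lt_trans _ _ (B * (2 * d))).
    by rewrite ler_wpM2l// mulr2n mulrDl mul1r lerD2l ltW.
  have : d <= e / (2 * (B + 1)) by rewrite ge_min lexx orbT.
  rewrite ler_pdivlMr ?mulr_gt0 ?ltr_wpDl// => dle.
  by apply: lt_le_trans dle; rewrite mulrA mulrC (mulrC B) ltr_pM2l// ltr_pM2l// ltrDl.
Qed.

End UnorderedJetProducts.

(** Leaving out an [F0] beyond which the bounds sum to at most [ln (3/2)] keeps every partial
    product within [1/2] of 1, hence the limit too, which is therefore nonzero. *)
Lemma unordered_prod_converges (R : realType) (I : choiceType) (S : set I)
    (g : I -> R[i] -> R[i]) (b : I -> R) (A : R) (h : R[i]) :
  (forall i, S i -> jet (fun h => g i h - 1) (expR (b i) - 1)) ->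
  (forall F : {fset I}, \sum_(i <- F | i \in S) b i <= A) ->
  modulus h <= 1 -> prod_converges S (g ^~ h).
Proof.
move=> gb bA h1; have TF := @summability.totally_filter I.
have ln32 : 0 < ln (3 / 2 : R) by apply: ln_gt0; lra.
have [F0 F0s] := summable_tail bA ln32; exists F0.
pose S' := S `\` [set` F0].
have S'S i : S' i -> S i by case.
(* The tail estimate is stated for sets containing [F0], so it is applied to the union of [F] and
   [F0]. *)
have b'A (F : {fset I}) : \sum_(i <- F | i \in S') b i <= ln (3 / 2).
  have F0F : (F0 `<=` F `|` F0)%fset by exact: fsubsetUr.
  have := ltW (F0s _ F0F); rewrite fsetDUl fsetDv fsetU0.
  rewrite -[X in X <= _ -> _]big_filter -[X in _ -> X <= _]big_filter.
  rewrite (perm_big [seq i <- F | i \in S'])//; apply: uniq_perm.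
  - exact/filter_uniq/fset_uniq.
  - exact/filter_uniq/fset_uniq.
  move=> i; rewrite !mem_filter in_fsetD in_setD andbA; congr (_ && _).
  by congr (_ && ~~ _); apply/idP/idP => [|/set_mem//]; exact: mem_set.
have gb' i (Si : S' i) := gb i (S'S i Si).
have cv := unordered_prod_cvg gb' b'A h1.
exists (unordered_prod S' (g ^~ h)); split => //; apply/negP => /eqP l0.
have : modulus (unordered_prod S' (g ^~ h) - 1) <= 2^-1.
  apply: dist_lim_le cv => F; apply: le_trans (jet_bound (partial_prod_jet gb' F) h1) _.
  have : expR (\sum_(i <- F | i \in S') b i) <= 3 / 2.
    by rewrite -[leRHS]lnK ?posrE ?divr_gt0// ler_expR.
  lra.
by rewrite l0 sub0r modulusN modulus1; lra.
Qed.

(** * From summable weighted marks to an entire product *)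

Section ElementaryProducts.
Variable R : realType.
Local Notation C := R[i].
Implicit Type eta : marked_config R.

Lemma ground_locally_finite eta : locally_finite (ground eta).
Proof.
have [gamma [n etaE]] := unmark_marked eta.
rewrite /ground etaE image_comp (_ : _ @` _ = points gamma); last first.
  by rewrite (_ : _ \o _ = id) ?image_id.
exact: points_locally_finite.
Qed.

Lemma mark_ground eta x : ground eta x -> points eta (x, mark eta x).
Proof. by move=> [[y n] yn /= <-]; rewrite /mark; case: xgetP => [m _ //|/(_ n)]. Qed.

(** Only finitely many points lie in the square of half-side 1. The sum of their inverse moduli
    (with inverse 0 at the origin) bounds each of them, and the summand 1 takes care of the points
    outside the unit disc. *)
Lemma Pi_support_inv_bounded eta :
  exists D : R, 0 <= D /\ forall x, Pi_support eta x -> (modulus x)^-1 <= D.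
Proof.
have /finite_fsetP[T TE] :=
  @ground_locally_finite eta _ (@complex_square_compact R 1).
have T0 (F : seq C) : 0 <= \sum_(x <- F) (modulus x)^-1.
  by apply: sumr_ge0 => x _; rewrite invr_ge0 modulus_ge0.
exists (1 + \sum_(x <- T) (modulus x)^-1); split => [|x [gx x0]].
  by rewrite addr_ge0.
have xp := modulus_gt0 x0.
have [x1|x1] := lerP 1 (modulus x).
  by apply: (@le_trans _ _ 1); rewrite ?invf_le1// lerDl.
have xT : x \in T.
  suff : [set` T] x by [].
  rewrite -TE; split => //; split.
    exact: le_trans (Re_le_modulus _) (ltW x1).
  exact: le_trans (Im_le_modulus _) (ltW x1).
by rewrite (big_rem x)//= addrCA lerDl addr_ge0.
Qed.

(** Both claims are local: near [z] the factors are regarded as jets in [h] of the elementary factor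
    at [(z + h) / x]. Convergence is read off at [h = 0], differentiability from the slopes at 0. *)
Lemma Pi_entire eta p (A : R) : (2 <= p)%N ->
  (forall F : {fset C}, \sum_(x <- F | x \in Pi_support eta)
     (val (mark eta x))%:R * (1 + modulus x) ^- 3 <= A) ->
  (forall z : C, prod_converges (Pi_support eta) (Pi_factor p z eta)) /\
  entire (Pi_prod p eta).
Proof.
move=> p2 sumA; have [D [D0 xD]] := Pi_support_inv_bounded eta.
set S := Pi_support eta.
suff local z : exists (b : C -> R) (B : R),
    [/\ forall x, S x -> jet (fun h => Pi_factor p (z + h) eta x - 1) (expR (b x) - 1) &
        forall F : {fset C}, \sum_(x <- F | x \in S) b x <= B].
  split=> z; have [b [B [jb bB]]] := local z.
    have := unordered_prod_converges (h := 0) jb bB.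
    by rewrite modulus0 addr0; exact.
  rewrite /derivable (_ : (fun h => _) = (fun h => h^-1 *
      (unordered_prod S (Pi_factor p (z + h) eta) -
       unordered_prod S (Pi_factor p (z + 0) eta)))); last first.
    apply/funext => h; rewrite /Pi_prod addr0 /=.
    have hz : h *: (1 : C) + z = z + h by rewrite addrC; congr (_ + _); exact: mulr1.
    by rewrite hz.
  exact: unordered_prod_slope_cvg jb bB.
(* A bound for the jet norm of [(z + h) / x], whose coefficients are [z / x] and [1 / x]. *)
pose c x := (modulus z + 1) / modulus x.
have z1 : 0 <= modulus z + 1 by rewrite addr_ge0 ?modulus_ge0.
have c0 x : S x -> 0 <= c x by move=> _; rewrite divr_ge0 ?modulus_ge0.
have cM x : S x -> c x <= (modulus z + 1) * D.
  by move=> Sx; rewrite ler_wpM2l// xD.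
have wO : jetO S c 1 (fun x h => (z + h) / x).
  exists 1 => // x Sx; rewrite mul1r expr1.
  have := jet_affine (z / x) x^-1.
  rewrite !modulusM modulusV -[X in _ + X]mul1r -mulrDl.
  by under eq_fun do rewrite -mulrDl.
have [K K0 jE] := jetO_elementary_factor c0 cM p2 wO.
exists (fun x => (val (mark eta x))%:R * (K * c x ^+ 3)).
(* The factor [D + 1] comes from [1/|x| <= (D + 1) / (1 + |x|)], which is [1/|x| <= D] rewritten.
   The jet bounds get their exponential form from [t <= expR t - 1]. *)
exists (K * ((modulus z + 1) * (D + 1)) ^+ 3 * A); split => [x Sx|F].
- apply: jet1X; apply: jet_le (jE x Sx).
  by have := expR_ge1Dx (K * c x ^+ 3); lra.
- apply: le_trans (ler_wpM2l _ (sumA F)); last first.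
    by rewrite mulr_ge0// exprn_ge0// mulr_ge0// addr_ge0.
  rewrite mulr_sumr; apply: ler_sum => x /set_mem Sx.
  rewrite [leRHS]mulrCA ler_wpM2l// -mulrA ler_wpM2l//.
  rewrite -exprVn -exprMn lerXn2r ?nnegrE ?c0//.
    by rewrite !mulr_ge0 ?invr_ge0 ?addr_ge0 ?modulus_ge0.
  have xp : 0 < modulus x by apply: modulus_gt0; case: Sx.
  rewrite -mulrA ler_wpM2l// ler_pdivlMr ?ltr_wpDl ?modulus_ge0//.
    by rewrite mulrDr mulr1 mulVf ?gt_eqF// lerD// xD.
Qed.

End ElementaryProducts.

(** * Poisson measures *)

Section Pairing.
Variables (X : topologicalType) (R : realType).
Implicit Types (f g : X -> R) (eta : config X).

Lemma C0Z (c : R) f : C0 f -> C0 (fun y => c * f y).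
Proof.
move=> [cf kf]; split.
  by move=> y; apply: cvgM; [exact: cvg_cst|exact: cf].
apply: subclosed_compact kf _; first exact: closed_closure.
by apply: closure_subset => y /=; apply: contraNneq => ->; rewrite mulr0.
Qed.

Lemma pairingZ (c : R) f eta : pairing (fun y => c * f y) eta = c * pairing f eta.
Proof. by rewrite /pairing mulr_fsumr. Qed.

Lemma pairing_ge0 f eta : (forall y, 0 <= f y) -> 0 <= pairing f eta.
Proof. by move=> f0; exact: fsumr_ge0. Qed.

(** Adjoining to [F] the finitely many points of [eta] where [f] is nonzero turns the pairing into
    an ordinary finite sum; comparisons of pairings reduce to it. *)
Lemma C0_cover f eta (F : {fset X}) : C0 f -> [set` F] `<=` points eta ->
  exists2 r : {fset X}, (F `<=` r)%fset &
    [set` r] `<=` points eta /\ pairing f eta = \sum_(y <- r) f y.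
Proof.
move=> [_ kf] Feta.
have fin := points_locally_finite eta kf.
have /finite_fsetP[r rE] : finite_set ([set` F] `|` (points eta `&` [set x | f x != 0])).
  rewrite finite_setU; split; first exact: finite_fset.
  by apply: sub_finite_set fin; apply: setIS; exact: subset_closure.
have req : [set` r] `<=` points eta by rewrite -rE => y [/Feta|[]].
exists r; first by apply/fsubsetP => y yF; suff: [set` r] y by []; rewrite -rE; left.
split=> //; rewrite /pairing (fsbigE r)//.
  by rewrite big_seq_cond [RHS]big_seq; apply: eq_bigl => y;
    apply/andP/idP => [[]//|yr]; split => //; exact/mem_set/req.
move=> y ey yr; apply/eqP; apply: contraNT yr => fy.
by suff: [set` r] y by []; rewrite -rE; right.
Qed.

Lemma sum_le_pairing f eta (F : {fset X}) : C0 f -> (forall y, 0 <= f y) ->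
  [set` F] `<=` points eta -> \sum_(y <- F) f y <= pairing f eta.
Proof.
move=> Cf f0 Feta; have [r Fr [_ ->]] := C0_cover Cf Feta.
by rewrite (big_fset_split _ xpredT f Fr)/= lerDl sumr_ge0.
Qed.

Lemma le_pairing f g eta : C0 f -> C0 g -> (forall y, 0 <= g y) ->
  (forall y, f y <= g y) -> pairing f eta <= pairing g eta.
Proof.
move=> Cf Cg g0 fg.
have sub0 : [set` (fset0 : {fset X})] `<=` points eta by move=> y; rewrite /= in_fset0.
have [r _ [reta ->]] := C0_cover Cf sub0.
by apply: le_trans (sum_le_pairing Cg g0 reta); exact: ler_sum.
Qed.

Lemma measurable_pairing f : C0 f ->
  measurable_fun setT (pairing f : Gamma X R -> R).
Proof.
move=> Cf _ B mB; apply: sub_sigma_algebra; exists f => //.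
by exists B.
Qed.

End Pairing.

(* Markov's inequality for [1 - exp (- Z)]. *)
Lemma laplace_markov (d : measure_display) (T : measurableType d) (R : realType)
    (Q : probability T R) (Z : T -> R) (L : R) :
  measurable_fun setT Z -> (forall t, 0 <= Z t) ->
  (\int[Q]_t (expR (- Z t))%:E = L%:E)%E ->
  (Q [set t | (1 < Z t)%R] <= (2 * (1 - L))%:E)%E.
Proof.
move=> mZ Z0 QL; pose E := [set t | 1 < Z t].
have mE : measurable E.
  rewrite (_ : E = setT `&` Z @^-1` `]1, +oo[%classic); first exact: mZ.
  by apply/seteqP; split => t /=; rewrite in_itv/= andbT => // -[].
have e2 : expR (-1 : R) <= 2^-1.
  by rewrite expRN lef_pV2 ?posrE ?expR_gt0//; have := expR_ge1Dx (1 : R); lra.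
(* On [E] the first term is at most [expR (-1) <= 1/2], off [E] the second vanishes. Integrating
   gives [L + Q E / 2 <= 1]. *)
have pg t : expR (- Z t) + 2^-1 * \1_E t <= 1.
  rewrite indicE; case: (boolP (t \in E)) => [/set_mem /= tE|_].
    have : expR (- Z t) <= expR (-1) by rewrite ler_expR lerN2 ltW.
    rewrite mulr1; lra.
  by rewrite mulr0 addr0 -expR0 ler_expR oppr_le0.
have m1E : measurable_fun setT (fun t => (\1_E t : R)%:E).
  by apply/measurable_EFinP; exact: measurable_indic.
have mhalf : measurable_fun setT (fun t => ((2^-1)%:E * (\1_E t)%:E : \bar R)%E).
  exact: measurable_funeM.
have mexp : measurable_fun setT (fun t => (expR (- Z t))%:E).
  apply/measurable_EFinP; apply: measurableT_comp => //.
  exact: measurable_funN.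
have exp0 t : setT t -> (0 <= (expR (- Z t))%:E)%E.
  by rewrite lee_fin expR_ge0.
have half0 t : setT t -> (0 <= (2^-1)%:E * (\1_E t)%:E :> \bar R)%E.
  by rewrite -EFinM lee_fin mulr_ge0.
have : (\int[Q]_t ((expR (- Z t))%:E + (2^-1)%:E * (\1_E t)%:E) <= 1)%E.
  rewrite -(probability_setT Q) -[X in (_ <= X)%E]mul1e -integral_cst//.
  apply: ge0_le_integral => //.
  - by move=> t _; rewrite adde_ge0 ?exp0 ?half0.
  - exact: emeasurable_funD.
  - by move=> t _; rewrite -EFinM -EFinD lee_fin.
rewrite (ge0_integralD Q measurableT exp0 mexp half0 mhalf) QL ge0_integralZl//.
rewrite integral_indic// setIT -/E.
have [q qE] : exists q, Q E = q%:E.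
  by exists (fine (Q E)); rewrite fineK// fin_num_measure.
rewrite qE [X in (_ * X)%E](_ : _ = q%:E)// -EFinM -EFinD !lee_fin; lra.
Qed.

(** The Laplace transform at [- f / a] is at least [1 - M / a], and [laplace_markov] converts this
    into a bound on the tail that involves [f] only through its integral. *)
Lemma poisson_tail (R : realType) (sigma : {measure set (R[i] * posnat) -> \bar R})
    (Q : probability (Gamma (R[i] * posnat)%type R) R)
    (f : R[i] * posnat -> R) (M a : R) :
  is_poisson sigma Q -> C0 f -> (forall y, 0 <= f y) -> measurable_fun setT f ->
  (\int[sigma]_y (f y)%:E <= M%:E)%E -> 0 < a ->
  (Q [set eta | (a < pairing f eta)%R] <= (2 * (M / a))%:E)%E.
Proof.
move=> QP Cf f0 mf fM a0.
pose g y := - a^-1 * f y.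
have Cg : C0 g by exact: C0Z.
have g0 y : g y <= 0 by rewrite mulr_le0_ge0// oppr_le0 invr_ge0 ltW.
have if_ : sigma.-integrable setT (EFin \o f).
  apply/integrableP; split; first exact/measurable_EFinP.
  under eq_integral do rewrite /= ger0_norm//.
  exact: le_lt_trans fM (ltry _).
have ig : sigma.-integrable setT (EFin \o g).
  by have := integrableZl measurableT (- a^-1) if_.
have mg : measurable_fun setT g by apply: measurable_funM.
have ie : sigma.-integrable setT (EFin \o (fun y => expR (g y) - 1)).
  apply: (le_integrable measurableT _ _ ig) => [|y _ /=].
    apply/measurable_EFinP; apply: measurable_funB => //.
    exact: measurableT_comp.
  rewrite lee_fin distrC ger0_norm; last by rewrite subr_ge0 -expR0 ler_expR.
  by rewrite ler0_norm//; have := expR_ge1Dx (g y); lra.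
(* The inequality [1 + u <= expR u] serves twice: for the outer exponential, and pointwise to bound
   the integrand below by [g]. *)
have lower : 1 - M / a <= expR (\int[sigma]_y (expR (g y) - 1))%R.
  apply: le_trans (expR_ge1Dx _); rewrite lerD2l.
  apply: (@le_trans _ _ (\int[sigma]_y (g y))%R); last first.
    apply: le_Rintegral => // y _; have := expR_ge1Dx (g y); lra.
  rewrite RintegralZl// mulNr lerN2 mulrC ler_wpM2r ?invr_ge0 ?(ltW a0)//.
  rewrite -lee_fin fineK//; exact: integrable_fin_num.
have Caf : C0 (fun y => a^-1 * f y) by exact: C0Z.
have := laplace_markov (measurable_pairing (R := R) Caf) _
  (L := expR (\int[sigma]_y (expR (g y) - 1))%R).
have -> : [set eta | 1 < pairing (fun y => a^-1 * f y) eta] =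
    [set eta | a < pairing f eta].
  by apply/seteqP; split => eta /=; rewrite pairingZ mulrC ltr_pdivlMr// mul1r.
move=> /(_ Q) tail; apply: le_trans (tail _ _) _.
- by move=> eta; apply: pairing_ge0 => y; rewrite mulr_ge0// invr_ge0 ltW.
- rewrite -QP//; apply: eq_integral => eta _.
  by rewrite !pairingZ mulNr.
- rewrite lee_fin; lra.
Qed.

(** * Test functions *)

Section Weight.
Variable R : realType.

(* [(1 + |a|)^(-3/2)]: the product of two such factors dominates [(1 + |z|)^-3] and
   integrates over the plane by Tonelli. *)
Definition weight (a : R) : R := (1 + `|a|)^-1 * (Num.sqrt (1 + `|a|))^-1.

Lemma norm1D_gt0 (a : R) : 0 < 1 + `|a|.
Proof. by rewrite ltr_pwDl. Qed.

Lemma weight_ge0 a : 0 <= weight a.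
Proof. by rewrite mulr_ge0 ?invr_ge0 ?sqrtr_ge0 ?(ltW (norm1D_gt0 _)). Qed.

Lemma weight_continuous : continuous weight.
Proof.
move=> a; have c1 : 1 + `|x| @[x --> a] --> 1 + `|a|.
  by apply: cvgD; [exact: cvg_cst|apply: cvg_norm; exact: cvg_id].
have a1 := norm1D_gt0 a.
apply: cvgM; first by apply: cvgV => //; rewrite gt_eqF.
apply: cvgV; first by rewrite gt_eqF// sqrtr_gt0.
by apply: continuous_cvg c1; exact: sqrt_continuous.
Qed.

Lemma weight_modulus (z : R[i]) :
  (1 + modulus z) ^- 3 <= weight (complex.Re z) * weight (complex.Im z).
Proof.
have z1 : 0 < 1 + modulus z by rewrite ltr_pwDl ?modulus_ge0.
have le a : `|a| <= modulus z ->
    (1 + modulus z)^-1 * (Num.sqrt (1 + modulus z))^-1 <= weight a.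
  move=> az; have a1 := norm1D_gt0 a.
  apply: ler_pM; rewrite ?invr_ge0 ?sqrtr_ge0 ?(ltW z1)//.
    by rewrite lef_pV2 ?posrE// lerD2l.
  by rewrite lef_pV2 ?posrE ?sqrtr_gt0// ler_sqrt ?(ltW z1)// lerD2l.
apply: le_trans (ler_pM _ _ (le _ (Re_le_modulus z)) (le _ (Im_le_modulus z))).
- by rewrite mulrACA -!invfM -expr2 -[X in _ * X]expr2 sqr_sqrtr ?(ltW z1)// -exprSr.
- by rewrite mulr_ge0 ?invr_ge0 ?sqrtr_ge0 ?(ltW z1).
- by rewrite mulr_ge0 ?invr_ge0 ?sqrtr_ge0 ?(ltW z1).
Qed.

Lemma integral_weight : (\int[lebesgue_measure]_a (weight a)%:E = 4%:E)%E.
Proof.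
rewrite ge0_symfun_integralT//; first last.
- by move=> a; rewrite /weight/= normrN.
- exact: weight_continuous.
- exact: weight_ge0.
rewrite (_ : [set x | 0 <= x] = `[0, +oo[%classic); last first.
  by apply/seteqP; split => x /=; rewrite in_itv/= andbT.
(* An antiderivative of [weight] on the half-line, rising from -2 to 0; evenness doubles the
   resulting 2. *)
pose F (x : R) := -2 * (Num.sqrt (1 + x))^-1.
have dF (x : R) : 0 <= x -> is_derive x 1 F (weight x).
  move=> x0; have x1 : 0 < 1 + x by rewrite ltr_pwDl.
  have s0 : 0 < Num.sqrt (1 + x) by rewrite sqrtr_gt0.
  have d1 : is_derive x 1 (fun y : R => 1 + y) 1.
    by have := is_deriveD (is_derive_cst (1 : R) x 1) (is_derive_id x (1 : R)); rewrite add0r.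
  have d2 := @is_derive1_comp _ Num.sqrt (fun y : R => 1 + y) x _ _ (is_derive1_sqrt x1) d1.
  have d3 := is_deriveV (f := Num.sqrt \o (fun y : R => 1 + y)) (lt0r_neq0 s0) d2.
  have d4 := @is_deriveZ _ _ _ _ (-2) _ _ _ d3.
  apply: is_derive_eq d4 _; rewrite /weight (ger0_norm x0) /= mulr1 sqr_sqrtr ?(ltW x1)//.
  set s := Num.sqrt _ in s0 *; rewrite /GRing.scale/=.
  by field; rewrite !gt_eqF.
rewrite (@ge0_continuous_FTC2y _ _ F 0 0).
- by rewrite /F addr0 sqrtr1 invr1 mulr1 -EFinB -EFinM; congr (_%:E); ring.
- by move=> x _; exact: weight_ge0.
- by apply: continuous_subspaceT; exact: weight_continuous.
- rewrite -(mulr0 (-2)); apply: cvgM; first exact: cvg_cst.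
  apply/gtr0_cvgV0.
    by near=> x; rewrite sqrtr_gt0 ltr_pwDl//; near: x; apply: nbhs_pinfty_ge; rewrite num_real.
  apply/cvgryPge => A; near=> x.
  have x0 : 0 <= x by near: x; apply: nbhs_pinfty_ge; rewrite num_real.
  have xA : A ^+ 2 <= x by near: x; apply: nbhs_pinfty_ge; rewrite num_real.
  rewrite (le_trans (ler_norm A))// -sqrtr_sqr ler_sqrt ?addr_ge0//.
  by rewrite (le_trans xA)// lerDr.
- by move=> x x0; have [] := dF x (ltW x0).
- apply: cvg_at_right_filter; apply: differentiable_continuous.
  by apply/derivable1_diffP; have [] := dF 0 (lexx 0).
- move=> x; rewrite in_itv/= andbT => x0.
  by rewrite derive1E; have [_ ->] := dF x (ltW x0).
Unshelve. all: by end_near. Qed.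

End Weight.

Section TestFunctions.
Variable R : realType.
Local Notation C := R[i].

(** A trapezoid, equal to 1 up to [k] and to 0 from [k + 1] on: the weight becomes compactly
    supported while staying continuous and nondecreasing in [k]. *)
Definition cutoff (k : nat) (a : R) : R := Num.max 0 (Num.min 1 (k.+1%:R - `|a|)).

Lemma cutoff_ge0 k a : 0 <= cutoff k a.
Proof. by rewrite /cutoff le_max lexx. Qed.

Lemma cutoff_le1 k a : cutoff k a <= 1.
Proof. by rewrite /cutoff ge_max ler01 ge_min lexx. Qed.

Lemma le_cutoff k l a : (k <= l)%N -> cutoff k a <= cutoff l a.
Proof.
move=> kl; have h : k.+1%:R - `|a| <= l.+1%:R - `|a| by rewrite lerD2r ler_nat.
by apply: le_max2 => //; exact: le_min2.
Qed.

Lemma cutoff1 (k : nat) a : `|a| <= k%:R -> cutoff k a = 1.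
Proof.
move=> ak; rewrite /cutoff min_l; first by rewrite max_r.
by rewrite lerBrDr -natr1 addrC lerD2r.
Qed.

Lemma cutoff0 k a : k.+1%:R <= `|a| -> cutoff k a = 0.
Proof.
by move=> ak; rewrite /cutoff max_l// ge_min subr_le0 ak orbT.
Qed.

Lemma cutoff_continuous k : continuous (cutoff k).
Proof.
have cn : continuous (fun a : R => k.+1%:R - `|a|).
  by move=> a; apply: cvgB; [exact: cvg_cst|apply: cvg_norm; exact: cvg_id].
move=> a; have c0 : {for a, continuous (cst 0 : R -> R^o)} by exact: cvg_cst.
have c1 : {for a, continuous (cst 1 : R -> R^o)} by exact: cvg_cst.
exact: continuous_max c0 (continuous_min c1 (cn a)).
Qed.

Definition profile k a : R := weight a * cutoff k a.

Lemma profile_ge0 k a : 0 <= profile k a.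
Proof. by rewrite mulr_ge0 ?weight_ge0 ?cutoff_ge0. Qed.

Lemma profile_le k a : profile k a <= weight a.
Proof. by rewrite ler_piMr ?weight_ge0 ?cutoff_le1. Qed.

Lemma le_profile k l a : (k <= l)%N -> profile k a <= profile l a.
Proof. by move=> kl; rewrite ler_wpM2l ?weight_ge0 ?le_cutoff. Qed.

Lemma profile_continuous k : continuous (profile k).
Proof. by move=> a; apply: cvgM; [exact: weight_continuous|exact: cutoff_continuous]. Qed.

(** Marks above [k] are sent to 0 rather than to [k], which gives compact support in the mark
    variable. *)
Definition capped_mark (k : nat) (n : posnat) : R :=
  if (val n <= k)%N then (val n)%:R else 0.

Lemma capped_mark_ge0 k n : 0 <= capped_mark k n.
Proof. by rewrite /capped_mark; case: ifP. Qed.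

Lemma capped_mark_le k n : capped_mark k n <= (val n)%:R.
Proof. by rewrite /capped_mark; case: ifP. Qed.

Lemma le_capped_mark k l n : (k <= l)%N -> capped_mark k n <= capped_mark l n.
Proof.
move=> kl; rewrite /capped_mark; case: ifP => [nk|_]; first by rewrite (leq_trans nk kl).
by case: ifP.
Qed.

(** Functions in [C0], nondecreasing in [k], whose eventual value is a majorant of
    [n (1 + |x|)^-3]. *)
Definition test_fun (k : nat) (y : C * posnat) : R :=
  capped_mark k y.2 * (profile k (complex.Re y.1) * profile k (complex.Im y.1)).

Lemma test_fun_ge0 k y : 0 <= test_fun k y.
Proof. by apply: mulr_ge0; [exact: capped_mark_ge0|apply: mulr_ge0; exact: profile_ge0]. Qed.

Lemma le_test_fun k l y : (k <= l)%N -> test_fun k y <= test_fun l y.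
Proof.
move=> kl; apply: ler_pM; [exact: capped_mark_ge0| |exact: le_capped_mark|].
  by apply: mulr_ge0; exact: profile_ge0.
by apply: ler_pM; [exact: profile_ge0|exact: profile_ge0|exact: le_profile|exact: le_profile].
Qed.

Lemma test_fun_le k y : test_fun k y <=
  (val y.2)%:R * (weight (complex.Re y.1) * weight (complex.Im y.1)).
Proof.
apply: ler_pM; [exact: capped_mark_ge0| |exact: capped_mark_le|].
  by apply: mulr_ge0; exact: profile_ge0.
by apply: ler_pM; [exact: profile_ge0|exact: profile_ge0|exact: profile_le|exact: profile_le].
Qed.

Lemma test_fun_eq (k : nat) y : modulus y.1 <= k%:R -> (val y.2 <= k)%N ->
  test_fun k y = (val y.2)%:R * (weight (complex.Re y.1) * weight (complex.Im y.1)).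
Proof.
move=> yk nk; rewrite /test_fun /capped_mark nk /profile !cutoff1 ?mulr1//.
  exact: le_trans (Im_le_modulus _) yk.
exact: le_trans (Re_le_modulus _) yk.
Qed.

Lemma measurable_Re : measurable_fun setT (@complex.Re R : C -> R).
Proof.
have m : measurable_fun setT (fun z : C => (complex.Re z, complex.Im z)).
  by move=> _ B mB; exists B.
exact: measurableT_comp measurable_fst m.
Qed.

Lemma measurable_Im : measurable_fun setT (@complex.Im R : C -> R).
Proof.
have m : measurable_fun setT (fun z : C => (complex.Re z, complex.Im z)).
  by move=> _ B mB; exists B.
exact: measurableT_comp measurable_snd m.
Qed.

Lemma measurable_posnat (g : posnat -> R) : measurable_fun setT g.
Proof. by []. Qed.

Lemma measurable_test_fun k : measurable_fun setT (test_fun k).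
Proof.
have mp := continuous_measurable_fun (@profile_continuous k).
apply: measurable_funM.
  exact: measurableT_comp (measurable_posnat _) measurable_snd.
apply: measurable_funM.
  by apply: measurableT_comp => //; exact: measurableT_comp measurable_Re measurable_fst.
by apply: measurableT_comp => //; exact: measurableT_comp measurable_Im measurable_fst.
Qed.

Lemma continuous_posnat (g : posnat -> R) : continuous g.
Proof. by apply/continuousP => A _; exact: discrete_open. Qed.

Lemma continuous_test_fun k : continuous (test_fun k).
Proof.
move=> y; have cf : {for y, continuous (@fst C posnat)} by exact: cvg_fst.
have cs : {for y, continuous (@snd C posnat)} by exact: cvg_snd.
apply: cvgM.
  exact: (continuous_comp cs (@continuous_posnat (capped_mark k) y.2)).
apply: cvgM.
  apply: (continuous_comp (f := fun y : C * posnat => complex.Re y.1)).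
    exact: (continuous_comp cf (@complex_re_continuous R y.1)).
  exact: profile_continuous.
apply: (continuous_comp (f := fun y : C * posnat => complex.Im y.1)).
  exact: (continuous_comp cf (@complex_im_continuous R y.1)).
exact: profile_continuous.
Qed.

Lemma C0_test_fun k : C0 (test_fun k).
Proof.
split; first exact: continuous_test_fun.
pose Q := [set z : C | `|complex.Re z| <= k.+1%:R /\ `|complex.Im z| <= k.+1%:R].
pose B := [set n : posnat | (val n <= k)%N].
have kQ : compact Q by exact: complex_square_compact.
have kB : compact B.
  (* The marks up to [k] lie in the image of the integers [0, ..., k]; the integer 0 goes to the
     default mark, which is harmless for an inclusion. *)
  apply: finite_compact; apply: (sub_finite_set _
    (finite_image (fun m => insubd (point : posnat) m) (finite_II k.+1))).
  by move=> n nk; exists (val n) => //; rewrite /= valKd.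
apply: (subclosed_compact _ (compact_setX kQ kB)); first exact: closed_closure.
have cQ : closed Q by apply: compact_closed kQ; exact: norm_hausdorff.
have cB : closed B by rewrite -openC; exact: discrete_open.
have cQB : closed (Q `*` B).
  rewrite (_ : Q `*` B = fst @^-1` Q `&` snd @^-1` B) //; apply: closedI.
    by apply: preimage_closed => // y _; exact: cvg_fst.
  by apply: preimage_closed => // y _; exact: cvg_snd.
rewrite ((closure_id (Q `*` B)).1 cQB); apply: closure_subset => -[z n] /=.
move=> tn0; split; last first.
  by apply: contraNT tn0 => /negbTE nk; rewrite /test_fun /capped_mark /= nk mul0r.
split; rewrite /= leNgt; apply: contraNN tn0 => /ltW/cutoff0 ck.
  by rewrite /test_fun /profile /= ck mulr0 mul0r mulr0.
by rewrite /test_fun /profile /= ck !mulr0.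
Qed.

End TestFunctions.

(** * Integrals of the test functions *)

Lemma area_sigma_finite (R : realType) : sigma_finite setT (@area R).
Proof.
pose I (n : nat) : set R := `[- n%:R, n%:R]%classic.
pose Q n := [set z : R[i] | I n (complex.Re z) /\ I n (complex.Im z)].
exists Q.
  apply/seteqP; split => // z _.
  exists (Num.bound (modulus z)) => //.
  have zb := ltW (archi_boundP (modulus_ge0 z)).
  by split; rewrite /I/= in_itv/= -ler_norml; apply: le_trans zb;
    [exact: Re_le_modulus|exact: Im_le_modulus].
move=> n.
have mI : measurable (I n) by exact: measurable_itv.
split; first by exists (I n `*` I n); [exact: measurableX|rewrite setTI].
rewrite /area /pushforward (_ : _ @^-1` _ = I n `*` I n)//.
rewrite product_measure1E//= /I lebesgue_measure_itv/=; case: ifPn => _.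
  by rewrite -EFinB -EFinM ltry.
by rewrite mul0e.
Qed.

HB.instance Definition _ (R : realType) :=
  @Measure_isSigmaFinite.Build _ _ R (@area R) (area_sigma_finite R).

Section Integrals.
Variable R : realType.

Lemma measurable_weight : measurable_fun setT (@weight R).
Proof. exact: continuous_measurable_fun (@weight_continuous R). Qed.

Lemma measurable_weight_weight : measurable_fun setT
  (fun z : R[i] => weight (complex.Re z) * weight (complex.Im z)).
Proof.
apply: measurable_funM; apply: measurableT_comp measurable_weight _.
  exact: measurable_Re.
exact: measurable_Im.
Qed.

(** Tonelli splits the integral into two copies of [integral_weight], and [4 * 4 = 16]. *)
Lemma integral_area_weight :
  (\int[@area R]_z (weight (complex.Re z) * weight (complex.Im z))%:E = 16%:E)%E.
Proof.
rewrite /area ge0_integral_pushforward//; first last.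
- by move=> z _; rewrite lee_fin mulr_ge0 ?weight_ge0.
- by apply/measurable_EFinP; exact: measurable_weight_weight.
- exact: measurable_complex_of_pair.
rewrite preimage_setT fubini_tonelli1//; first last.
- by move=> z; rewrite lee_fin mulr_ge0 ?weight_ge0.
- apply/measurable_EFinP; apply: measurable_funM.
    exact: measurableT_comp measurable_weight measurable_fst.
  exact: measurableT_comp measurable_weight measurable_snd.
rewrite /fubini_F/=.
under eq_integral => a _.
  under eq_integral do rewrite EFinM.
  rewrite ge0_integralZl//; first last.
  - by rewrite lee_fin weight_ge0.
  - by move=> b _; rewrite lee_fin weight_ge0.
  - by apply/measurable_EFinP; exact: measurable_weight.
  rewrite integral_weight muleC.
  over.
rewrite ge0_integralZl//; first last.
- by move=> b _; rewrite lee_fin weight_ge0.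
- by apply/measurable_EFinP; exact: measurable_weight.
by rewrite integral_weight -EFinM; congr (_%:E); ring.
Qed.

(** The majorant is a function of the mark times a function of the position, so Tonelli gives the
    mean mark times 16, uniformly in [k]. *)
Lemma integral_test_fun_le (lambda : probability posnat R) (L : R) (k : nat) :
  (\int[lambda]_n ((val n)%:R)%:E = L%:E)%E ->
  (\int[(@area R \x lambda)%E]_y (test_fun k y)%:E <= (16 * L)%:E)%E.
Proof.
move=> LE.
have mW : measurable_fun setT (fun y : R[i] * posnat =>
    (val y.2)%:R * (weight (complex.Re y.1) * weight (complex.Im y.1)) : R).
  apply: measurable_funM.
    exact: measurableT_comp (measurable_posnat (fun n => (val n)%:R)) measurable_snd.
  exact: measurableT_comp measurable_weight_weight measurable_fst.
have W0 (y : R[i] * posnat) :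
    0 <= (val y.2)%:R * (weight (complex.Re y.1) * weight (complex.Im y.1)) :> R.
  by rewrite mulr_ge0// mulr_ge0 ?weight_ge0.
apply: (@le_trans _ _ (\int[(@area R \x lambda)%E]_y
   ((val y.2)%:R * (weight (complex.Re y.1) * weight (complex.Im y.1)))%:E)%E).
  apply: ge0_le_integral => //.
  - by move=> y _; rewrite lee_fin test_fun_ge0.
  - by apply/measurable_EFinP; exact: measurable_test_fun.
  - exact/measurable_EFinP.
  - by move=> y _; rewrite lee_fin test_fun_le.
rewrite fubini_tonelli1//; last exact/measurable_EFinP.
rewrite /fubini_F/=.
under eq_integral => z _.
  under eq_integral do rewrite mulrC EFinM.
  rewrite ge0_integralZl//; first last.
  - by rewrite lee_fin mulr_ge0 ?weight_ge0.
  rewrite LE muleC.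
  over.
have L0 : (0 <= L%:E)%E by rewrite -LE integral_ge0.
rewrite ge0_integralZl//; first last.
- by move=> b _; rewrite lee_fin mulr_ge0 ?weight_ge0.
- by apply/measurable_EFinP; exact: measurable_weight_weight.
by rewrite integral_area_weight -EFinM mulrC.
Qed.

End Integrals.

(** * Almost sure summability of the weighted marks *)

Section Summability.
Variable R : realType.
Local Notation C := R[i].
Local Notation G := (Gamma (C * posnat)%type R).

(** The null set is the intersection over [m] of the events [U m] that some pairing exceeds [m + 1].
    The tail bound is uniform in [k] and the events [E m k] grow with [k], so it passes to [U m]; it
    tends to 0 as [m] grows. *)
Lemma pairing_test_fun_unbounded_null (lambda : probability posnat R)
    (Q : probability G R) (L : R) :
  is_poisson (@area R \x lambda)%E Q ->
  (\int[lambda]_n ((val n)%:R)%:E = L%:E)%E ->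
  exists2 N : set G, measurable N /\ Q N = 0%E &
    forall eta : G, ~ N eta -> exists A : R, forall k, pairing (@test_fun R k) eta <= A.
Proof.
move=> QP LE.
pose E m k : set G := [set eta | m.+1%:R < pairing (@test_fun R k) eta].
have mE m k : measurable (E m k).
  rewrite (_ : E m k = setT `&` pairing (@test_fun R k) @^-1` `]m.+1%:R, +oo[%classic).
    exact: (measurable_pairing (@C0_test_fun R k)).
  by apply/seteqP; split => eta /=; rewrite in_itv/= andbT => // -[].
pose U m := \bigcup_k E m k.
have mU m : measurable (U m) by exact: bigcupT_measurable.
have QU m : (Q (U m) <= (2 * (16 * L / m.+1%:R))%:E)%E.
  have ndE : {homo E m : k l / (k <= l)%N >-> (k <= l)%O}.
    move=> k l kl; apply/subsetPset => eta /= /lt_le_trans; apply.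
    apply: le_pairing; [exact: C0_test_fun|exact: C0_test_fun|exact: test_fun_ge0|].
    by move=> y; exact: le_test_fun.
  have cv := nondecreasing_cvg_mu (mu := Q) (mE m) (mU m) ndE.
  rewrite -(cvg_lim _ cv)//; apply: lime_le; first by apply/cvg_ex; eexists; exact: cv.
  apply: nearW => k; apply: poisson_tail QP _ _ _ _ _ => //.
  - exact: C0_test_fun.
  - exact: test_fun_ge0.
  - exact: measurable_test_fun.
  - exact: integral_test_fun_le.
exists (\bigcap_m U m).
  split; first exact: bigcapT_measurable.
  have [q qE] : exists q, Q (\bigcap_m U m) = q%:E.
    exists (fine (Q (\bigcap_m U m))); rewrite fineK// fin_num_measure//.
    exact: bigcapT_measurable.
  have q0 : 0 <= q by rewrite -lee_fin -qE.
  have qm m : q <= 2 * (16 * L / m.+1%:R).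
    rewrite -lee_fin -qE; apply: le_trans (QU m); apply: le_measure.
    - by apply/mem_set; exact: bigcapT_measurable.
    - exact/mem_set.
    - exact: bigcap_inf.
  rewrite qE; congr (_%:E); apply/eqP; rewrite eq_le q0 andbT leNgt; apply/negP => qp.
  (* If [q] were positive, any [m] with [m + 1 > b] would contradict [qm m]. *)
  pose b := 2 * (16 * L) / q.
  have L0 : 0 <= L by rewrite -lee_fin -LE integral_ge0.
  have b0 : 0 <= b by rewrite divr_ge0 ?mulr_ge0.
  have := qm (Num.bound b); rewrite mulrA ler_pdivlMr// leNgt => /negP; apply.
  rewrite -ltr_pdivrMl// mulrC -/b; apply: lt_trans (archi_boundP b0) _.
  by rewrite ltr_nat.
move=> eta /existsNP[m /not_implyP[_ Um]]; exists m.+1%:R => k.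
by rewrite leNgt; apply/negP => lt; apply: Um; exists k.
Qed.

(** A finite set [F] is within reach of a single test function: with [k] above all its moduli and
    marks, nothing is truncated on it, and the finite sum is bounded by the pairing. *)
Lemma sum_marks_le (eta : marked_config R) (A : R) :
  (forall k, pairing (@test_fun R k) eta <= A) ->
  forall F : {fset C}, \sum_(x <- F | x \in Pi_support eta)
     (val (mark eta x))%:R * (1 + modulus x) ^- 3 <= A.
Proof.
move=> etaA F.
pose k := \max_(x <- F) maxn (Num.bound (modulus x)) (val (mark eta x)).
have kP x : x \in F -> modulus x <= k%:R /\ (val (mark eta x) <= k)%N.
  move=> xF; have := leq_bigmax_seq
    (F := fun x => maxn (Num.bound (modulus x)) (val (mark eta x))) x xF isT.
  rewrite geq_max => /andP[bk nk]; split => //.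
  apply: le_trans (ltW (archi_boundP (modulus_ge0 x))) _.
  by rewrite ler_nat.
pose r := [seq (x, mark eta x) | x <- F & x \in Pi_support eta].
have ur : uniq r.
  by rewrite map_inj_uniq ?filter_uniq ?fset_uniq// => x y [].
pose F' := [fset y in r]%fset.
have F'eta : [set` F'] `<=` points eta.
  move=> y; rewrite /= !inE => /mapP[x]; rewrite mem_filter => /andP[/set_mem[gx _] _] ->.
  exact: mark_ground.
have /le_trans := sum_le_pairing (@C0_test_fun R k) (@test_fun_ge0 R k) F'eta.
move/(_ A (etaA k)).
apply: le_trans.
rewrite (perm_big r)/=; last first.
  by apply: uniq_perm => [|//|y]; [exact: fset_uniq|rewrite !inE].
rewrite big_map big_filter big_seq_cond [leRHS]big_seq_cond.
apply: ler_sum => x /andP[xF _]; have [xk nk] := kP x xF.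
by rewrite test_fun_eq//= ler_wpM2l// weight_modulus.
Qed.

End Summability.

Theorem theorem3p1 (R : realType) (lambda : probability posnat R)
    (pi_ml : probability (markedGamma R) R)
    (pi_mlP : is_marked_poisson lambda pi_ml)
    (mean_finite : (\int[lambda]_n ((val n)%:R)%:E < +oo)%E)
    (p : nat) (p_ge2 : (2 <= p)%N) :
  {ae pi_ml, forall eta : markedGamma R,
    (forall z : R[i], prod_converges (Pi_support eta) (Pi_factor p z eta)) /\
    entire (Pi_prod p eta)}.
Proof.
have [Q [QP QR]] := pi_mlP.
have [L LE] : exists L : R, (\int[lambda]_n ((val n)%:R)%:E = L%:E)%E.
  exists (fine (\int[lambda]_n ((val n)%:R)%:E)%E); rewrite fineK// ge0_fin_numE//.
  by apply: integral_ge0 => n _; rewrite lee_fin.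
have [N [mN QN] NP] := pairing_test_fun_unbounded_null QP LE.
(* The exceptional set is the trace of [N] on the marked configurations, null by the definition of
   the restriction; it does not depend on [p]. *)
exists (@marked_inclusion R @^-1` N); split.
- by exists N => //; rewrite setTI.
- by rewrite QR.
move=> eta /= bad; apply: contrapT => etaN; apply: bad.
have [A etaA] := NP _ etaN.
exact: Pi_entire p_ge2 (sum_marks_le etaA).
Qed.
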